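(* Let $\mathcal C$ be a Hilbert space tensor category and let $(\rho,(U^x)_{x\in\mathcal C})$ and $(\check\rho,(\check U^x)_{x\in\mathcal C})$ be two natural right absorbers for $\mathcal C$. Let $\mathcal H:=\mathrm{For}(\rho)$, $\check{\mathcal H}:=\mathrm{For}(\check\rho)$, and let $U:=U^\rho\in\mathcal U(\mathcal H\otimes\mathcal H)$ and $\check U:=\check U^{\check\rho}\in\mathcal U(\check{\mathcal H}\otimes\check{\mathcal H})$ be the corresponding multiplicative unitaries. The unitaries $$V:=U^{\check\rho}\in\mathcal U(\check{\mathcal H}\otimes\mathcal H),\qquad W:=\check U^{\rho}\in\mathcal U(\mathcal H\otimes\check{\mathcal H})$$ satisfy the following equations: $$U_{23}V_{12}=V_{12}V_{13}U_{23},\qquad \check U_{23}W_{12}=W_{12}W_{13}\check U_{23},$$ $$V_{23}\check U_{12}=\check U_{12}V_{13}V_{23},\qquad W_{23}U_{12}=U_{12}W_{13}W_{23},$$ $$V_{23}W_{12}=W_{12}U_{13}V_{23},\qquad W_{23}V_{12}=V_{12}\check U_{13}W_{23}.$$ If the multiplicative unitaries $U$ and $\check U$ are manageable, then $V$ and $W$ give morphisms between the corresponding $C^*$-quantum groups that are inverse to each other in the category of $C^*$-quantum groups.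
   Context: Leg numbering notation is used; $\mathcal U(\cdot)$ denotes the unitary group. A Hilbert space tensor category is a monoidal $W^*$-category $\mathcal C$ with a faithful, strict monoidal functor $\mathrm{For}\colon\mathcal C\to\mathbf{Hilb}$ to the $W^*$-category of Hilbert spaces (with bounded operators, usual $\otimes$) and a strict monoidal functor $\tau\colon\mathbf{Hilb}\to\mathcal C$ with $\mathrm{For}\circ\tau=\mathrm{id}$. ''Strict monoidal'' means: tensor products are preserved on the nose, the unit of $\mathcal C$ is $\tau(\mathbb C)$, and associators and unit maps correspond to the obvious ones of Hilbert spaces. $\mathcal C(x_1,x_2)$ is identified with a weakly closed subspace of $\mathbb B(\mathrm{For}(x_1),\mathrm{For}(x_2))$; an operator in it is said to come from $\mathcal C$. Two assumptions are required: (1) if $\mathrm{For}(x)=\mathrm{For}(x')$ and the identity operator comes from an arrow $x\to x'$, then $x=x'$; (2) if $a\colon\mathrm{For}(x_1)\to\mathrm{For}(x_2)$ is such that $a\otimes\mathrm{id}$ comes from an arrow $x_1\otimes y\to x_2\otimes y$, or $\mathrm{id}\otimes a$ comes from an arrow $y\otimes x_1\to y\otimes x_2$, for some object $y$, then $a$ comes from an arrow $x_1\to x_2$. For an object $x$ write $\tau(x):=\tau(\mathrm{For}(x))$. The flips $x\otimes\tau(\mathcal H)\leftrightarrow\tau(\mathcal H)\otimes x$ come from $\mathcal C$, so for $T\in\mathcal C(x_1\otimes x_2,y_1\otimes y_2)$ the operator $T_{13}$ is an arrow $x_1\otimes\tau(\mathcal H)\otimes x_2\to y_1\otimes\tau(\mathcal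 H)\otimes y_2$. A natural right absorber in $\mathcal C$ is an object $\rho$ with unitary arrows $U^x\colon x\otimes\rho\to\tau(x)\otimes\rho$ for all objects $x$ such that (i) $U^{x_2}(a\otimes\mathrm{id}_\rho)=(a\otimes\mathrm{id}_\rho)U^{x_1}$ for all $a\in\mathcal C(x_1,x_2)$; (ii) $U^{x_1\otimes x_2}=U^{x_1}_{13}U^{x_2}_{23}$ for all objects $x_1,x_2$. We also write $U^x$ for the underlying operator in $\mathcal U(\mathrm{For}(x)\otimes\mathrm{For}(\rho))$. It is known that $U^\rho$ is then a multiplicative unitary, that is, $U^\rho_{23}U^\rho_{12}=U^\rho_{12}U^\rho_{13}U^\rho_{23}$. A multiplicative unitary $\mathbb W\in\mathcal U(\mathcal H\otimes\mathcal H)$ is manageable if there are a strictly positive (possibly unbounded, self-adjoint, positive, trivial kernel) operator $Q$ on $\mathcal H$ and $\widetilde{\mathbb W}\in\mathcal U(\overline{\mathcal H}\otimes\mathcal H)$ with $\mathbb W^*(Q\otimes Q)\mathbb W=Q\otimes Q$ and $\langle x\otimes u,\mathbb W(z\otimes y)\rangle=\langle\overline z\otimes Qu,\widetilde{\mathbb W}(\overline x\otimes Q^{-1}y)\rangle$ for all $x,z\in\mathcal H$, $u\in D(Q)$, $y\in D(Q^{-1})$ (inner products linear in the second variable). A $C^*$-quantum group is a $C^*$-bialgebra generated by a manageable multiplicative unitary. Category of $C^*$-quantum groups (Meyer–Roy–Woronowicz): for $C^*$-quantum groups generated by manageable $\mathbb W^1\in\mathcal U(\mathcal H_1\otimes\mathcal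 H_1)$ and $\mathbb W^2\in\mathcal U(\mathcal H_2\otimes\mathcal H_2)$, a morphism from the first to the second is a unitary $X\in\mathcal U(\mathcal H_1\otimes\mathcal H_2)$ (bicharacter) with $X_{23}\mathbb W^1_{12}=\mathbb W^1_{12}X_{13}X_{23}$ and $\mathbb W^2_{23}X_{12}=X_{12}X_{13}\mathbb W^2_{23}$; the composite of $X\colon 1\to2$ and $Y\colon2\to3$ is the unique unitary $Y*X\in\mathcal U(\mathcal H_1\otimes\mathcal H_3)$ with $Y_{23}X_{12}=X_{12}(Y*X)_{13}Y_{23}$; the identity morphism is $\mathbb W^1$. *)

(* Defs.v *)
From HB Require Import structures.
From mathcomp Require Import all_boot all_order all_algebra.
From mathcomp Require Import complex.
From mathcomp Require Import all_classical all_reals topology normedtype.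
From mathcomp Require Import ring.

Set Implicit Arguments.
Unset Strict Implicit.
Unset Printing Implicit Defensive.

Import Order.TTheory GRing.Theory Num.Theory.
Import numFieldNormedType.Exports.

Local Open Scope classical_set_scope.
Local Open Scope ring_scope.

(* R[i] carries a second module structure (over R) in complex.v; this name
   pins down its structure of numClosedFieldType. *)
Definition Cplx (R : realType) : numClosedFieldType := R[i].

Section Cplx_complete.
Variable R : realType.
Local Notation C := (Cplx R).

Lemma Cplx_complete (F : set_system C^o) :
  ProperFilter F -> cauchy F -> cvg F.
Proof.
move=> FF /cauchy_ballP Fc.
pose re (z : C) : R := complex.Re z; pose im (z : C) : R := complex.Im z.
have reB (z w : C) : re (z - w) = re z - re w by case: z w => [a b] [c d].
have imB (z w : C) : im (z - w) = im z - im w by case: z w => [a b] [c d].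
have normlt (e : R) (z : C) : `|z| < (e%:C%C : C) ->
    `|re z| < e /\ `|im z| < e.
  move=> ze; have e0 : 0 < e.
    by rewrite -ltcR; apply: le_lt_trans ze; exact: normr_ge0.
  case: z ze => a b; rewrite (normc_def (a +i* b)%C) ltcR => ze.
  have {ze} : a ^+ 2 + b ^+ 2 < e ^+ 2.
    rewrite -ltr_sqrt ?exprn_gt0// sqrtr_sqr ger0_norm //; exact: ltW.
  move=> ze; split; rewrite -(@ltr_pXn2r _ 2) ?nnegrE ?normr_ge0 ?(ltW e0)//;
    rewrite real_normK ?num_real //; apply: le_lt_trans ze.
    by rewrite lerDl sqr_ge0.
  by rewrite lerDr sqr_ge0.
have cauchy_part (p : C -> R) : (forall z w, p (z - w) = p z - p w) ->
    (forall (e : R) (z : C), `|z| < (e%:C%C : C) -> `|p z| < e) -> cvg (p @ F).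
  move=> pB plt; apply: cauchy_cvg; apply/cauchy_ballP => e e0.
  have ec0 : 0 < (e%:C%C : C) by rewrite (@ltcR R 0 e).
  have H := Fc _ ec0; rewrite near_map2.
  apply: (@filterS _ (filter_prod F F) _ _ _ _ H) => -[x y] /=.
  by rewrite -!ball_normE /= => /plt; rewrite pB.
have cre : cvg (re @ F) by apply: cauchy_part => // e z /normlt[].
have cim : cvg (im @ F) by apply: cauchy_part => // e z /normlt[].
apply/cvg_ex; exists ((lim (re @ F)) +i* (lim (im @ F)))%C.
apply/cvgrPdist_lt => /= e e0.
have [e' e'0 ee'] : exists2 e' : R, 0 < e' & e = (e'%:C%C : C).
  have /complex_realP[k ek] : e \is Num.real by exact: gtr0_real.
  by exists k => //; rewrite -ltcR -ek.
have e20 : 0 < e' / 2 by rewrite divr_gt0.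
have nR (k : R) : `|k%:C%C : C| = (`|k|)%:C%C.
  by rewrite normc_def /= expr0n addr0 sqrtr_sqr.
have key (l m a b : R) : `|l - a| < e' / 2 -> `|m - b| < e' / 2 ->
    `|(l +i* m)%C - (a +i* b)%C : C| < e.
  move=> hr hi; have -> : (l +i* m)%C - (a +i* b)%C =
      (l - a)%:C%C + 'i%C * (m - b)%:C%C :> C.
    by apply/eqP; rewrite eq_complex /= !(mul0r, mul1r, mulr0, subr0, add0r, addr0) !eqxx.
  apply: le_lt_trans (ler_normD _ _) _.
  rewrite normrM; have -> : `|'i%C : C| = 1.
    by rewrite normc_def /= expr0n expr1n add0r sqrtr1.
  by rewrite mul1r !nR ee' -raddfD /= ltcR [e'](splitr e') ltrD.
have keyz l m (z : C) : `|l - re z| < e' / 2 -> `|m - im z| < e' / 2 ->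
    `|(l +i* m)%C - z : C| < e by case: z => a b; exact: key.
near=> z; apply: keyz.
  by near: z; move/cvgrPdist_lt : cre; exact.
by near: z; move/cvgrPdist_lt : cim; exact.
Unshelve. all: by end_near. Qed.

End Cplx_complete.

(* The one-dimensional Hilbert space: a name of its own, because the library
   already attaches a completeness instance to R^o for R : realType. *)
Definition CH (R : realType) : Type := (Cplx R)^o.
HB.instance Definition _ (R : realType) := NormedModule.copy (CH R) (Cplx R)^o.
HB.instance Definition _ (R : realType) :=
  Uniform_isComplete.Build (CH R) (@Cplx_complete R).

(* inner products are linear in the second variable *)
HB.mixin Record CompleteNormedModule_isHilbert (R : realType) V
    & CompleteNormedModule (Cplx R) V := {
  dot : V -> V -> Cplx R;
  dotDr : forall x y z, dot x (y + z) = dot x y + dot x z;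
  dotZr : forall a x y, dot x (a *: y) = a * dot x y;
  dot_conj : forall x y, (dot x y)^* = dot y x;
  dot_norm : forall x, dot x x = `|x| ^+ 2 }.

#[short(type="hilbertType")]
HB.structure Definition Hilbert (R : realType) :=
  { V of CompleteNormedModule (Cplx R) V & CompleteNormedModule_isHilbert R V }.

Section CH_hilbert.
Variable R : realType.
Implicit Types x y z : CH R.
Let d x y : Cplx R := (x : Cplx R)^* * y.
Let dDr x y z : d x (y + z) = d x y + d x z. Proof. exact: mulrDr. Qed.
Let dZr (a : Cplx R) x y : d x (a *: y) = a * d x y.
Proof. exact: mulrCA. Qed.
Let dC x y : (d x y)^* = d y x.
Proof. by rewrite /d rmorphM /= conjCK mulrC. Qed.
Let dn x : d x x = `|x| ^+ 2.
Proof. by rewrite /d mulrC -normCK. Qed.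
HB.instance Definition _ :=
  CompleteNormedModule_isHilbert.Build R (CH R) dDr dZr dC dn.
End CH_hilbert.

Section hilbert_theory.
Variables (R : realType) (H : hilbertType R).
Implicit Types x y z : H.
Local Notation C := (Cplx R).

Lemma dotDl x y z : dot (x + y) z = dot x z + dot y z.
Proof. by rewrite -dot_conj dotDr rmorphD /= !dot_conj. Qed.
Lemma dotZl (a : C) x y : dot (a *: x) y = a^* * dot x y.
Proof. by rewrite -dot_conj dotZr rmorphM /= dot_conj. Qed.
Lemma dot0r x : dot x 0 = 0.
Proof. by rewrite -[0 in LHS](scale0r 0) dotZr mul0r. Qed.
Lemma dot0l x : dot 0 x = 0.
Proof. by rewrite -dot_conj dot0r rmorph0. Qed.
Lemma dotNr x y : dot x (- y) = - dot x y.
Proof. by rewrite -scaleN1r dotZr mulN1r. Qed.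
Lemma dotNl x y : dot (- x) y = - dot x y.
Proof. by rewrite -dot_conj dotNr rmorphN /= dot_conj. Qed.
Lemma dotBr x y z : dot x (y - z) = dot x y - dot x z.
Proof. by rewrite dotDr dotNr. Qed.
Lemma dotBl x y z : dot (x - y) z = dot x z - dot y z.
Proof. by rewrite dotDl dotNl. Qed.
Lemma dot_suml (I : Type) (s : seq I) (f : I -> H) y :
  dot (\sum_(i <- s) f i) y = \sum_(i <- s) dot (f i) y.
Proof.
by elim/big_rec2 : _ => [|i a b _ <-]; [rewrite dot0l | rewrite dotDl].
Qed.
Lemma dot_sumr (I : Type) (s : seq I) (f : I -> H) y :
  dot y (\sum_(i <- s) f i) = \sum_(i <- s) dot y (f i).
Proof.
by elim/big_rec2 : _ => [|i a b _ <-]; [rewrite dot0r | rewrite dotDr].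
Qed.
Lemma dot_ge0 x : 0 <= dot x x.
Proof. by rewrite dot_norm exprn_ge0. Qed.
Lemma dot_eq0 x : dot x x = 0 -> x = 0.
Proof. by rewrite dot_norm => /eqP; rewrite sqrf_eq0 normr_eq0 => /eqP. Qed.
End hilbert_theory.

Lemma quad_ge0 (C : numClosedFieldType) (p q b : C) : 0 <= p -> 0 <= q ->
  (forall c : C, 0 <= p + c * b + (c * b)^* + `|c| ^+ 2 * q) ->
  `|b| ^+ 2 <= p * q.
Proof.
move=> p0 q0 H.
have [b0|b0] := eqVneq b 0; first by rewrite b0 normr0 expr0n mulr_ge0.
have nb : 0 < `|b| ^+ 2 by rewrite exprn_gt0 // normr_gt0.
have [q00|q0'] := eqVneq q 0.
  have := H (- ((p + 1) / `|b| ^+ 2) * b^*).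
  rewrite q00 mulr0 addr0 -mulrA [b^* * b]mulrC -normCK mulNr divfK ?gt_eqF //.
  have cp : (p + 1)^* = p + 1 by apply/CrealP; rewrite ger0_real // addr_ge0.
  have -> : p + - (p + 1) = -1 by rewrite opprD addrA subrr add0r.
  rewrite rmorphN /= cp -opprD oppr_ge0 => h.
  have : (0 : C) < 0 by apply: lt_le_trans h; rewrite ltr_pwDl ?ltr01 ?addr_ge0.
  by rewrite ltxx.
have qp : 0 < q by rewrite lt_def q0' q0.
have := H (- (b^* / q)).
rewrite mulNr mulrAC [b^* * b]mulrC -normCK.
have -> : (- (`|b| ^+ 2 / q))^* = - (`|b| ^+ 2 / q).
  by apply/CrealP; rewrite rpredN ger0_real // divr_ge0 // ltW.
rewrite normrN normrM norm_conjC normfV (ger0_norm q0) exprMn exprVn.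
have -> : `|b| ^+ 2 * q ^- 2 * q = `|b| ^+ 2 / q.
  by rewrite -mulrA -exprVn expr2 -(mulrA q^-1) mulVf ?mulr1 ?gt_eqF.
by rewrite subrK subr_ge0 ler_pdivrMr.
Qed.

Section cauchy_schwarz.
Variables (R : realType) (H : hilbertType R).
Implicit Types x y z : H.
Lemma dot_CS x y : `|dot x y| <= `|x| * `|y|.
Proof.
rewrite -(@ler_pXn2r _ 2) ?nnegrE ?normr_ge0 ?mulr_ge0 // exprMn -!dot_norm.
apply: quad_ge0; rewrite ?dot_ge0 // => c.
have := dot_ge0 (x + c *: y).
rewrite dotDl !dotDr !dotZl !dotZr addrA => h.
suff -> : `|c| ^+ 2 * dot y y = c^* * (c * dot y y).
  by rewrite rmorphM /= dot_conj.
by rewrite mulrA [c^* * c]mulrC -normCK.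
Qed.
End cauchy_schwarz.

Lemma small_factor (C : numFieldType) (M e : C) : 0 <= M -> 0 < e ->
  exists2 d, 0 < d & M * d < e.
Proof.
move=> M0 e0; have M1 : 0 < M + 1 by rewrite ltr_wpDl.
exists (e / (M + 1)); first exact: divr_gt0.
by rewrite mulrCA gtr_pMr // ltr_pdivrMr // mul1r ltrDl.
Qed.

Lemma le_small (C : numFieldType) (M a b : C) : 0 <= M ->
  (forall e, 0 < e -> a <= b + M * e) -> a <= b.
Proof.
move=> M0 h; apply/ler_addgt0Pr => e /(small_factor M0)[d d0 de].
by apply: le_trans (h _ d0) _; rewrite lerD2l ltW.
Qed.

(* Completion of a positive definite kernel k on X, as a reproducing kernel
   Hilbert space: s : seq (Cplx R * X) stands for the formal combination
   \sum_(p <- s) p.1 k_(p.2), and the space consists of the functions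
   phi : X -> Cplx R that are limits of such combinations, the pairing of phi
   with s being fs_eval s phi. *)
Section formal_sums.
Variables (R : realType) (X : Type) (k : X -> X -> Cplx R).
Local Notation C := (Cplx R).
Local Notation S := (seq (C * X)).

Definition fs_scale (c : C) (s : S) : S := [seq (c * p.1, p.2) | p <- s].
Definition fs_eval (t : S) (phi : X -> C) : C :=
  \sum_(p <- t) (p.1)^* * phi p.2.
Definition fs_fun (s : S) (x : X) : C := \sum_(p <- s) p.1 * k x p.2.
Definition fs_form (t s : S) : C := fs_eval t (fs_fun s).

Record posdef_kernel : Prop := PosdefKernel {
  kernel_conj : forall x y, (k x y)^* = k y x;
  kernel_ge0 : forall s, 0 <= fs_form s s }.

Hypothesis kP : posdef_kernel.
Local Notation ev := fs_eval.
Local Notation kf := fs_fun.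
Local Notation B := fs_form.
Definition fs_norm (s : S) : C := sqrtC (B s s).
Local Notation N := fs_norm.

Lemma ev_cat s t phi : ev (s ++ t) phi = ev s phi + ev t phi.
Proof. by rewrite /fs_eval big_cat. Qed.
Lemma ev_scale c s phi : ev (fs_scale c s) phi = c^* * ev s phi.
Proof.
rewrite /fs_eval big_map mulr_sumr; apply: eq_bigr => p _ /=.
by rewrite rmorphM /= mulrA.
Qed.
Lemma evD s phi psi : ev s (phi + psi) = ev s phi + ev s psi.
Proof. by rewrite /fs_eval -big_split /=; under eq_bigr do rewrite mulrDr. Qed.
Lemma evZ c s phi : ev s (c *: phi) = c * ev s phi.
Proof.
by rewrite /fs_eval mulr_sumr; apply: eq_bigr => p _; rewrite mulrCA.
Qed.
Lemma kf_cat s t : kf (s ++ t) = kf s + kf t.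
Proof. by apply/funext => x; rewrite /fs_fun big_cat. Qed.
Lemma kf_scale c s : kf (fs_scale c s) = c *: kf s.
Proof.
apply/funext => x; rewrite /fs_fun big_map /= [RHS]mulr_sumr.
by apply: eq_bigr => p _; rewrite mulrA.
Qed.
Lemma B_conj s t : (B s t)^* = B t s.
Proof.
rewrite /fs_form /fs_eval /fs_fun rmorph_sum /=.
under eq_bigr do rewrite rmorphM /= conjCK rmorph_sum /= mulr_sumr.
rewrite exchange_big /=; apply: eq_bigr => p _; rewrite mulr_sumr.
by apply: eq_bigr => q _; rewrite rmorphM /= (kernel_conj kP) mulrCA mulrA.
Qed.
Lemma N_ge0 s : 0 <= N s.
Proof. by rewrite sqrtC_ge0 (kernel_ge0 kP). Qed.
Lemma N_sqr s : N s ^+ 2 = B s s.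
Proof. exact: sqrtCK. Qed.
Lemma B_CS s t : `|B s t| <= N s * N t.
Proof.
rewrite -(@ler_pXn2r _ 2) ?nnegrE ?normr_ge0 ?mulr_ge0 ?N_ge0 //.
rewrite exprMn !N_sqr; apply: quad_ge0; rewrite ?(kernel_ge0 kP) // => c.
have := kernel_ge0 kP (s ++ fs_scale c t).
rewrite /fs_form kf_cat kf_scale ev_cat !evD !ev_scale !evZ -!/(fs_form _ _).
rewrite addrA => h.
suff -> : `|c| ^+ 2 * B t t = c^* * (c * B t t).
  by rewrite rmorphM /= B_conj.
by rewrite mulrA [c^* * c]mulrC -normCK.
Qed.
Lemma N_scale c s : N (fs_scale c s) = `|c| * N s.
Proof.
rewrite /fs_norm /fs_form kf_scale ev_scale evZ mulrA [c^* * c]mulrC -normCK.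
by rewrite sqrtCM ?nnegrE ?exprn_ge0 ?(kernel_ge0 kP) // sqrCK.
Qed.

Definition fs_approx (phi : X -> C) s (e : C) :=
  forall t, `|ev t phi - B t s| <= e * N t.
Local Notation approx := fs_approx.
Definition fs_bound (phi : X -> C) (M : C) := forall t, `|ev t phi| <= M * N t.
Local Notation bnd := fs_bound.
Definition kernel_mem (phi : X -> C) := forall e, 0 < e -> exists s, approx phi s e.

Lemma approx_le phi s e e' : e <= e' -> approx phi s e -> approx phi s e'.
Proof.
move=> ee' h t; apply: le_trans (h t) _.
by rewrite ler_wpM2r // N_ge0.
Qed.
Lemma approx_kf s : approx (kf s) s 0.
Proof. by move=> t; rewrite subrr normr0 mul0r. Qed.
Lemma bnd_kf s : bnd (kf s) (N s).
Proof. by move=> t; rewrite mulrC; exact: B_CS. Qed.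
Lemma bndD phi psi M M' : bnd phi M -> bnd psi M' -> bnd (phi + psi) (M + M').
Proof.
move=> h h' t; rewrite evD mulrDl; apply: le_trans (ler_normD _ _) _.
by rewrite lerD.
Qed.
Lemma bndZ c phi M : bnd phi M -> bnd (c *: phi) (`|c| * M).
Proof. by move=> h t; rewrite evZ normrM -mulrA ler_wpM2l. Qed.
Lemma approx_bnd phi s e : approx phi s e -> bnd (phi - kf s) e.
Proof.
move=> h t; rewrite evD -scaleN1r evZ mulN1r; exact: h.
Qed.
Lemma bnd_approx phi s e : bnd (phi - kf s) e -> approx phi s e.
Proof.
move=> h t; move: (h t); rewrite evD -scaleN1r evZ mulN1r; exact.
Qed.
Lemma kmem_bnd phi : kernel_mem phi -> exists2 M, 0 <= M & bnd phi M.
Proof.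
move=> /(_ 1 ltr01)[s /approx_bnd h]; exists (1 + N s).
  by rewrite addr_ge0 ?N_ge0.
by have := bndD h (bnd_kf s); rewrite subrK.
Qed.
Lemma approxD phi psi s t e f : approx phi s e -> approx psi t f ->
  approx (phi + psi) (s ++ t) (e + f).
Proof.
move=> /approx_bnd h /approx_bnd h'; apply: bnd_approx.
by have := bndD h h'; rewrite kf_cat opprD addrACA.
Qed.
Lemma approxZ c phi s e : approx phi s e ->
  approx (c *: phi) (fs_scale c s) (`|c| * e).
Proof.
move=> /approx_bnd h; apply: bnd_approx.
by have := bndZ c h; rewrite kf_scale scalerBr.
Qed.
Lemma N_le_of_bnd s M : 0 <= M -> bnd (kf s) M -> N s <= M.
Proof.
move=> M0 /(_ s); rewrite -/(B s s) -N_sqr ger0_norm ?exprn_ge0 ?N_ge0 //.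
have [->//|N0] := eqVneq (N s) 0.
by rewrite expr2 ler_pM2r // lt_def N0 N_ge0.
Qed.
Lemma approx_N phi s t e f : 0 <= e -> 0 <= f -> approx phi s e ->
  approx phi t f -> N (s ++ fs_scale (-1) t) <= e + f.
Proof.
move=> e0 f0 /approx_bnd h /approx_bnd h'.
apply: N_le_of_bnd; first exact: addr_ge0.
rewrite kf_cat kf_scale scaleN1r.
have := bndD (bndZ (-1) h) h'.
by rewrite normrN1 mul1r scaleN1r addrA opprB subrK.
Qed.

Definition kernel_pred : {pred X -> C} := mem [set phi | kernel_mem phi].
Lemma kernel_mem_lin : submod_closed kernel_pred.
Proof.
split; rewrite ?inE /=.
  move=> e e0; exists [::]; apply: (approx_le (ltW e0)) => t.
  rewrite mul0r /fs_form /fs_fun; under [fun _ => _]eq_fun do rewrite big_nil.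
  by rewrite subrr normr0.
move=> a f g; rewrite !inE /= => hf hg e e0.
have a0 : 0 < `|a| + 1 by rewrite ltr_wpDl.
have e1 : 0 < e / 2 / (`|a| + 1) by rewrite !divr_gt0.
have [s hs] := hf _ e1; have [t ht] := hg _ (divr_gt0 e0 (ltr0n _ 2)).
exists (fs_scale a s ++ t); apply: (approx_le _ (approxD (approxZ a hs) ht)).
rewrite [leRHS](splitr e) lerD2r mulrCA ler_piMr ?divr_ge0 ?ltW //.
by rewrite ltr_pdivrMr // mul1r ltrDl.
Qed.

Definition kfilter phi : set_system S :=
  filter_from [set e : C | 0 < e] (fun e => [set s | approx phi s e]).

Lemma kfilter_proper phi : kernel_mem phi -> ProperFilter (kfilter phi).
Proof.
move=> h; apply: filter_from_proper; last by move=> e /= /h[s]; exists s.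
apply: filter_from_filter; first by exists 1 => /=; exact: ltr01.
move=> e f /= e0 f0; have [ef|fe] := real_leP (gtr0_real e0) (gtr0_real f0).
  by exists e => // s /= hs; split => //; exact: approx_le hs.
by exists f => // s /= hs; split => //; apply: approx_le hs; exact: ltW.
Qed.

Definition kdot phi psi : C := lim ((ev s psi : CH R) @[s --> kfilter phi]).

Lemma kdot_cvg phi psi : kernel_mem phi -> kernel_mem psi ->
  (ev s psi : CH R) @[s --> kfilter phi] --> (kdot phi psi : CH R).
Proof.
move=> hphi hpsi; have PF := kfilter_proper hphi.
suff: cvg ((ev s psi : CH R) @[s --> kfilter phi]) by [].
apply: cauchy_cvg; apply: cauchy_exP => e e0.
have [M M0 hM] := kmem_bnd hpsi.
have M20 : 0 <= M *+ 2 by rewrite mulrn_wge0.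
have [d d0 Mde] := small_factor M20 e0.
have [t ht] := hphi _ d0; exists (ev t psi); exists d => // s /= hs.
rewrite -ball_normE /=.
have -> : ev t psi - ev s psi = ev (t ++ fs_scale (-1) s) psi.
  by rewrite ev_cat ev_scale rmorphN rmorph1 mulN1r.
apply: le_lt_trans (hM _) _; apply: le_lt_trans Mde.
by rewrite mulrnAl -mulrnAr ler_wpM2l // mulr2n; apply: approx_N ht hs; exact: ltW.
Qed.

Lemma kdot_approx phi psi s e M : kernel_mem phi -> kernel_mem psi ->
  0 <= e -> approx phi s e -> 0 <= M -> bnd psi M ->
  `|kdot phi psi - ev s psi| <= M * e.
Proof.
move=> hphi hpsi e0 hs M0 hM.
have PF := kfilter_proper hphi.
have M1 : 0 <= M + 1 by rewrite addr_ge0.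
apply: (le_small M1) => d d0.
have /cvgrPdist_le /(_ d d0) h1 := kdot_cvg hphi hpsi.
have h2 : kfilter phi [set t | approx phi t d] by exists d.
have [t [/= ht1 ht2]] := filter_ex (filterI h1 h2).
rewrite -(subrK (ev t psi) (kdot phi psi)) -addrA.
apply: le_trans (ler_normD _ _) _.
have -> : M * e + (M + 1) * d = d + M * (d + e) by ring.
apply: lerD => //.
have -> : ev t psi - ev s psi = ev (t ++ fs_scale (-1) s) psi.
  by rewrite ev_cat ev_scale rmorphN rmorph1 mulN1r.
apply: le_trans (hM _) _; rewrite ler_wpM2l //.
by apply: (approx_N _ _ ht2 hs) => //; exact: ltW.
Qed.

Lemma kdot_kf s psi : kernel_mem (kf s) -> kernel_mem psi ->
  kdot (kf s) psi = ev s psi.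
Proof.
move=> hs hpsi; have [M M0 hM] := kmem_bnd hpsi.
have := kdot_approx hs hpsi (lexx 0) (approx_kf s) M0 hM.
by rewrite mulr0 normr_le0 subr_eq0 => /eqP.
Qed.

Lemma kdot_lin a phi psi chi : kernel_mem phi -> kernel_mem psi ->
  kernel_mem chi -> kernel_mem (a *: psi + chi) ->
  kdot phi (a *: psi + chi) = a * kdot phi psi + kdot phi chi.
Proof.
move=> h1 h2 h3 h4; have PF := kfilter_proper h1.
have c1 := cvgD (cvgZl_tmp (k := a) (kdot_cvg h1 h2)) (kdot_cvg h1 h3).
apply: (@cvg_lim (CH R)); first exact: norm_hausdorff.
have E : (fun s => ev s (a *: psi + chi) : CH R) = (a \*: (fun s => ev s psi : CH R) + (fun s => ev s chi : CH R)).
  by apply/funext => s; rewrite evD evZ.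
rewrite E. exact: c1.
Qed.

Lemma approx_N_bnd phi s e M : 0 <= e -> 0 <= M -> approx phi s e ->
  bnd phi M -> N s <= M + e.
Proof.
move=> e0 M0 /approx_bnd h hM; apply: N_le_of_bnd; first exact: addr_ge0.
have := bndD hM (bndZ (-1) h).
by rewrite normrN1 mul1r scaleN1r opprB addrC subrK.
Qed.

Lemma kdot_conj phi psi : kernel_mem phi -> kernel_mem psi ->
  (kdot phi psi)^* = kdot psi phi.
Proof.
move=> h1 h2; have [M M0 hM] := kmem_bnd h1; have [K K0 hK] := kmem_bnd h2.
apply/eqP; rewrite -subr_eq0 -normr_le0.
have P0 : 0 <= K + K + M + M + 1 + 1 by rewrite !addr_ge0.
apply/ler_addgt0Pr => d' d'0; rewrite add0r.
have [d d0 dd'] := small_factor P0 d'0; apply: le_trans (ltW dd').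
pose e := d / (1 + d).
have d10 : 0 < 1 + d by rewrite addr_gt0.
have e0 : 0 < e by rewrite divr_gt0.
have e1 : e <= 1 by rewrite ler_pdivrMr // mul1r lerDr.
have ed : e <= d by rewrite ler_pdivrMr // ler_peMr ?lerDl ?ltW.
have [s hs] := h1 _ e0; have [t ht] := h2 _ e0.
have a1 := kdot_approx h1 h2 (ltW e0) hs K0 hK.
have a2 := kdot_approx h2 h1 (ltW e0) ht M0 hM.
have a3 := ht s; have a4 := hs t.
have n1 := approx_N_bnd (ltW e0) M0 hs hM.
have n2 := approx_N_bnd (ltW e0) K0 ht hK.
apply: le_trans (_ : (K + K + M + M + 1 + 1) * e <= _); last by rewrite ler_wpM2l.
have {}a1 : `|(kdot phi psi)^* - (ev s psi)^*| <= K * e.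
  by rewrite -rmorphB /= norm_conjC.
have {}a3 : `|(ev s psi)^* - B t s| <= (M + 1) * e.
  rewrite -B_conj -rmorphB /= norm_conjC; apply: le_trans a3 _.
  rewrite mulrC ler_wpM2r ?(ltW e0) //; apply: le_trans n1 _; by rewrite lerD2l.
have {}a4 : `|B t s - ev t phi| <= (K + 1) * e.
  rewrite distrC; apply: le_trans a4 _.
  rewrite mulrC ler_wpM2r ?(ltW e0) //; apply: le_trans n2 _; by rewrite lerD2l.
rewrite distrC in a2.
have -> : (kdot phi psi)^* - kdot psi phi =
  ((kdot phi psi)^* - (ev s psi)^*) + ((ev s psi)^* - B t s)
  + (B t s - ev t phi) + (ev t phi - kdot psi phi).
  by rewrite !addrA !subrK.
have -> : (K + K + M + M + 1 + 1) * e =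
    K * e + (M + 1) * e + (K + 1) * e + M * e.
  by rewrite -!mulrDl; congr (_ * _); ring.
apply: le_trans (ler_normD _ _) _; apply: lerD a2.
apply: le_trans (ler_normD _ _) _; apply: lerD a4.
by apply: le_trans (ler_normD _ _) _; apply: lerD a1 a3.
Qed.

Lemma kdot_ge0 phi : kernel_mem phi -> 0 <= kdot phi phi.
Proof.
move=> h; have [M M0 hM] := kmem_bnd h.
have Cr : kdot phi phi \is Num.real by apply/CrealP; exact: kdot_conj.
suff : - kdot phi phi <= 0 by rewrite oppr_le0.
have P0 : 0 <= M + (M + 1) by rewrite !addr_ge0.
apply/ler_addgt0Pr => d' d'0; rewrite add0r.
have [d d0 dd'] := small_factor P0 d'0; apply: le_trans (ltW dd').
pose e := d / (1 + d).
have d10 : 0 < 1 + d by rewrite addr_gt0.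
have e0 : 0 < e by rewrite divr_gt0.
have e1 : e <= 1 by rewrite ler_pdivrMr // mul1r lerDr.
have ed : e <= d by rewrite ler_pdivrMr // ler_peMr ?lerDl ?ltW.
have [s hs] := h _ e0.
have a1 := kdot_approx h h (ltW e0) hs M0 hM.
have a2 := hs s.
have n1 := approx_N_bnd (ltW e0) M0 hs hM.
apply: le_trans (_ : (M + (M + 1)) * e <= _); last by rewrite ler_wpM2l.
have {}a2 : `|ev s phi - B s s| <= (M + 1) * e.
  apply: le_trans a2 _.
  rewrite mulrC ler_wpM2r ?(ltW e0) //; apply: le_trans n1 _; by rewrite lerD2l.
have : `|kdot phi phi - B s s| <= (M + (M + 1)) * e.
  rewrite mulrDl -(subrK (ev s phi) (kdot phi phi)) -addrA.
  by apply: le_trans (ler_normD _ _) _; apply: lerD.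
apply: le_trans; rewrite distrC.
apply: le_trans (_ : B s s - kdot phi phi <= _).
  by rewrite lerDr (kernel_ge0 kP).
by rewrite real_ler_norm // rpredB // ger0_real // (kernel_ge0 kP).
Qed.
End formal_sums.

Section kernel_space.
Variables (R : realType) (X : Type) (k : X -> X -> Cplx R).
Hypothesis kP : posdef_kernel k.
Local Notation C := (Cplx R).

HB.instance Definition _ :=
  GRing.isSubmodClosed.Build C (X -> C) (kernel_pred k) (kernel_mem_lin kP).

Record kspace (p : posdef_kernel k) : Type := KSpace {
  kspace_val : X -> C; kspaceP : kspace_val \in kernel_pred k }.
Local Notation T := (kspace kP).
HB.instance Definition _ := [isSub for @kspace_val kP].
HB.instance Definition _ := [Choice of T by <:].
HB.instance Definition _ := [SubChoice_isSubLmodule of T by <:].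

Implicit Types f g h : T.

Lemma kspace_mem f : kernel_mem k (val f).
Proof. by have := valP f; rewrite inE. Qed.

Definition kform f g : C := kdot k (val f) (val g).

Lemma kform_lin f a g h : kform f (a *: g + h) = a * kform f g + kform f h.
Proof.
have E : val (a *: g + h) = a *: val g + val h by rewrite linearP.
rewrite /kform E (kdot_lin kP (kspace_mem f) (kspace_mem g) (kspace_mem h))//.
by rewrite -E; exact: kspace_mem.
Qed.
Lemma kformC f g : (kform f g)^* = kform g f.
Proof. exact: (kdot_conj kP (kspace_mem f) (kspace_mem g)). Qed.
Lemma kform_ge0 f : 0 <= kform f f.
Proof. exact: (kdot_ge0 kP (kspace_mem f)). Qed.
Lemma kformDr f g h : kform f (g + h) = kform f g + kform f h.
Proof. by rewrite -[g]scale1r kform_lin mul1r scale1r. Qed.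
Lemma kform0r f : kform f 0 = 0.
Proof. by apply: (addrI (kform f 0)); rewrite -kformDr !addr0. Qed.
Lemma kformZr a f g : kform f (a *: g) = a * kform f g.
Proof. by rewrite -[a *: g]addr0 kform_lin kform0r addr0. Qed.
Lemma kformDl f g h : kform (f + g) h = kform f h + kform g h.
Proof. by rewrite -kformC kformDr rmorphD /= !kformC. Qed.
Lemma kformZl a f g : kform (a *: f) g = a^* * kform f g.
Proof. by rewrite -kformC kformZr rmorphM /= kformC. Qed.

Definition knorm f : C := sqrtC (kform f f).
Lemma knorm_ge0 f : 0 <= knorm f.
Proof. by rewrite sqrtC_ge0 kform_ge0. Qed.
Lemma knorm_sqr f : knorm f ^+ 2 = kform f f.
Proof. exact: sqrtCK. Qed.
Lemma kform_CS f g : `|kform f g| <= knorm f * knorm g.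
Proof.
rewrite -(@ler_pXn2r _ 2) ?nnegrE ?normr_ge0 ?mulr_ge0 ?knorm_ge0 //.
rewrite exprMn !knorm_sqr; apply: quad_ge0; rewrite ?kform_ge0 // => c.
have := kform_ge0 (f + c *: g).
rewrite kformDl !kformDr !kformZl !kformZr addrA => H.
suff -> : `|c| ^+ 2 * kform g g = c^* * (c * kform g g).
  by rewrite rmorphM /= kformC.
by rewrite mulrA [c^* * c]mulrC -normCK.
Qed.

Lemma fs_fun_mem s : fs_fun k s \in kernel_pred k.
Proof.
rewrite inE /= => e e0; exists s; exact: (approx_le kP (ltW e0) (approx_kf k s)).
Qed.
Definition ksum s : T := KSpace kP (fs_fun_mem s).

Lemma kform_ksum s g : kform (ksum s) g = fs_eval s (val g).
Proof. exact: (kdot_kf kP (kspace_mem (ksum s)) (kspace_mem g)). Qed.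
Lemma knorm_ksum s : knorm (ksum s) = fs_norm k s.
Proof. by rewrite /knorm kform_ksum. Qed.

Lemma knormD f g : knorm (f + g) <= knorm f + knorm g.
Proof.
rewrite -(@ler_pXn2r _ 2) ?nnegrE ?addr_ge0 ?knorm_ge0 //.
rewrite knorm_sqr kformDl !kformDr sqrrD !knorm_sqr -addrA -[leRHS]addrA lerD2l.
rewrite addrA addrC [leRHS]addrC lerD2l.
have H : kform f g + kform g f \is Num.real.
  by apply/CrealP; rewrite rmorphD /= !kformC addrC.
apply: le_trans (real_ler_norm H) _; apply: le_trans (ler_normD _ _) _.
by rewrite mulr2n lerD ?kform_CS // [X in _ <= X]mulrC kform_CS.
Qed.
Lemma knormZ a f : knorm (a *: f) = `|a| * knorm f.
Proof.
rewrite /knorm kformZl kformZr mulrA [a^* * a]mulrC -normCK.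
by rewrite sqrtCM ?nnegrE ?exprn_ge0 ?kform_ge0 // sqrCK.
Qed.
Lemma kspace_valE f x : val f x = kform (ksum [:: (1, x)]) f.
Proof. by rewrite kform_ksum /fs_eval big_seq1 rmorph1 mul1r. Qed.
Lemma kspace_val_le f x : `|val f x| <= fs_norm k [:: (1, x)] * knorm f.
Proof. by rewrite kspace_valE; apply: le_trans (kform_CS _ _) _; rewrite knorm_ksum. Qed.
Lemma knorm0_eq0 f : knorm f = 0 -> f = 0.
Proof.
move=> f0; apply: val_inj; apply/funext => x.
have := kspace_val_le f x; rewrite f0 mulr0 normr_le0 => /eqP ->.
by rewrite [RHS](_ : _ = 0).
Qed.

HB.instance Definition _ :=
  @Lmodule_isNormed.Build C T knorm knormD knormZ knorm0_eq0.

Lemma knormE f : `|f| = knorm f. Proof. by []. Qed.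

Lemma knorm_bnd f M : 0 <= M -> fs_bound k (val f) M -> `|f| <= M.
Proof.
move=> M0 hM; rewrite knormE -(@ler_pXn2r _ 2) ?nnegrE ?knorm_ge0 // knorm_sqr.
have P0 : 0 <= M + M by rewrite addr_ge0.
apply: (le_small P0) => e e0; have [s hs] := kspace_mem f e0.
have a1 := kdot_approx kP (kspace_mem f) (kspace_mem f) (ltW e0) hs M0 hM.
have n1 := approx_N_bnd kP (ltW e0) M0 hs hM.
rewrite -(ger0_norm (kform_ge0 f)).
have -> : kform f f = (kform f f - fs_eval s (val f)) + fs_eval s (val f).
  by rewrite subrK.
apply: le_trans (ler_normD _ _) _.
have -> : M ^+ 2 + (M + M) * e = M * e + M * (M + e) by ring.
apply: lerD a1 _; apply: le_trans (hM s) _.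
by rewrite ler_wpM2l.
Qed.

Lemma bnd_knorm f : fs_bound k (val f) `|f|.
Proof.
move=> t; rewrite -kform_ksum mulrC -knorm_ksum; exact: kform_CS.
Qed.

Lemma ksum_dense f (e : C) : 0 < e -> exists s, `|f - ksum s| <= e.
Proof.
move=> e0; have [s hs] := kspace_mem f e0; exists s.
by apply: (knorm_bnd (ltW e0)); exact: (approx_bnd hs).
Qed.

Lemma kspace_complete (F : set_system T) : ProperFilter F -> cauchy F -> cvg F.
Proof.
move=> PF /cauchy_ballP Fc.
have cvx x : cvg ((val f x : CH R) @[f --> F]).
  apply: cauchy_cvg; apply/cauchy_ballP => e e0.
  have [d d0 de] := small_factor (N_ge0 kP [:: (1, x)]) e0.
  have H := Fc d d0; rewrite near_map2.
  apply: (@filterS _ (filter_prod F F) _ _ _ _ H) => -[f g] /=.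
  rewrite -!ball_normE /= => /ltW fg; apply: le_lt_trans de.
  have -> : val f x - val g x = val (f - g) x by [].
  apply: le_trans (kspace_val_le _ _) _.
  by rewrite ler_wpM2l ?(N_ge0 kP).
pose l (x : X) : C := lim ((val f x : CH R) @[f --> F]).
have cvt t : (fs_eval t (val f) : CH R) @[f --> F] --> (fs_eval t l : CH R).
  elim: t => [|p t IH].
    have -> : (fun f : T => fs_eval [::] (val f) : CH R) = (fun=> 0).
      by apply/funext => f; rewrite /fs_eval big_nil.
    by rewrite /fs_eval big_nil; exact: cvg_cst.
  have c1 := cvgD (cvgZl_tmp (k := (p.1)^*) (cvx p.2)) IH.
  have -> : (fun f : T => fs_eval (p :: t) (val f) : CH R) =
     (p.1)^* \*: (fun f : T => val f p.2 : CH R) +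
     (fun f : T => fs_eval t (val f) : CH R).
    by apply/funext => f; rewrite /fs_eval big_cons.
  by rewrite /fs_eval big_cons; exact: c1.
have key (e : C) : 0 < e -> exists2 A, F A & forall f, A f -> fs_bound k (val f - l) e.
  move=> e0; have [[A A'] /= [FA FA'] AA'] := Fc e e0.
  exists A => // f Af t.
  apply/ler_addgt0Pr => d d0.
  have /cvgrPdist_le /(_ d d0) h1 := cvt t.
  have [g [/= gA' gd]] := filter_ex (filterI FA' h1).
  have /= := AA' (f, g) (conj Af gA'); rewrite -ball_normE /= => /ltW fg.
  have -> : fs_eval t (val f - l) =
      fs_eval t (val (f - g)) + - (fs_eval t l - fs_eval t (val g)).
    have evB u v : fs_eval t (u - v) = fs_eval t u - fs_eval t v :> C.
      by rewrite evD -scaleN1r evZ mulN1r.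
    by rewrite raddfB /= !evB; ring.
  apply: le_trans (ler_normD _ _) _; rewrite normrN; apply: lerD gd.
  apply: le_trans (bnd_knorm _ t) _.
  by rewrite ler_wpM2r ?(N_ge0 kP).
have lmem : l \in kernel_pred k.
  rewrite inE => e e0; have e20 : 0 < e / 2 by rewrite divr_gt0.
  have [A FA hA] := key _ e20; have [f /= Af] := filter_ex FA.
  have [s hs] := kspace_mem f e20; exists s; apply: bnd_approx.
  have := bndD (bndZ (-1) (hA _ Af)) (approx_bnd hs).
  rewrite normrN1 mul1r -splitr scaleN1r opprB addrA.
  by rewrite -[l - _ + _]addrA [- val f + _]addrC subrr addr0.
apply/cvg_ex; exists (KSpace kP lmem); apply/cvgrPdist_le => /= e e0.
have [A FA hA] := key _ e0; apply: filterS FA => f /hA hf.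
rewrite distrC; apply: (knorm_bnd (ltW e0)); exact: hf.
Qed.

HB.instance Definition _ := Uniform_isComplete.Build T kspace_complete.

Let kformnorm f : kform f f = `|f| ^+ 2. Proof. by rewrite -knorm_sqr. Qed.
HB.instance Definition _ :=
  CompleteNormedModule_isHilbert.Build R T kformDr
    (fun a f g => kformZr a f g) kformC kformnorm.

Definition kvec x : T := ksum [:: (1, x)].
Lemma dot_kvec x y : dot (kvec x) (kvec y) = k x y.
Proof.
rewrite [LHS]kform_ksum /fs_eval big_seq1 rmorph1 mul1r /= /fs_fun big_seq1.
by rewrite mul1r.
Qed.
Lemma kspace_valE' f x : val f x = dot (kvec x) f.
Proof. exact: kspace_valE. Qed.
Lemma ksumE s : ksum s = \sum_(p <- s) p.1 *: kvec p.2.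
Proof.
apply: val_inj; apply/funext => x; rewrite [RHS]kspace_valE' dot_sumr.
by apply: eq_bigr => p _; rewrite dotZr dot_kvec.
Qed.
Lemma kvec_total f (e : C) : 0 < e ->
  exists s : seq (C * X), `|f - \sum_(p <- s) p.1 *: kvec p.2| <= e.
Proof. by move=> /(ksum_dense f)[s]; rewrite ksumE; exists s. Qed.
End kernel_space.

Record bop (R : realType) (H K : hilbertType R) := Bop {
  bop_fun :> H -> K;
  bop_linear : linear bop_fun;
  bop_continuous : continuous bop_fun }.

HB.instance Definition _ (R : realType) (H K : hilbertType R) (A : bop H K) :=
  GRing.isLinear.Build _ _ _ _ (bop_fun A) (@bop_linear _ _ _ A).

Section bop_theory.
Variable R : realType.
Implicit Types H K L : hilbertType R.

Lemma bop_ext H K (A B : bop H K) : A =1 B -> A = B.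
Proof.
case: A B => f lf cf [g lg cg] /= /funext fg; subst g.
by congr Bop; exact: Prop_irrelevance.
Qed.

Lemma bopD H K (A : bop H K) x y : A (x + y) = A x + A y.
Proof. exact: linearD. Qed.
Lemma bopZ H K (A : bop H K) c x : A (c *: x) = c *: A x.
Proof. exact: linearZ. Qed.

Lemma bop_bounded H K (A : bop H K) :
  exists2 M, 0 <= M & forall x, `|A x| <= M * `|x|.
Proof.
have /linear_bounded_continuous/linear_boundedP := @bop_continuous _ _ _ A.
by move=> /pinfty_ex_gt0[M M0 h]; exists M; [exact: ltW|].
Qed.

Lemma bop_of_bounded H K (f : H -> K) (M : Cplx R) : linear f ->
  (forall x, `|f x| <= M * `|x|) -> 0 <= M -> exists A : bop H K, f = A.
Proof.
move=> lf bf M0.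
pose F : {linear H -> K} := HB.pack f (GRing.isLinear.Build _ _ _ _ f lf).
have cF : continuous F.
  apply/linear_bounded_continuous/linear_boundedP; near=> r => x.
  apply: le_trans (bf x) _; rewrite ler_wpM2r //.
  by near: r; apply: nbhs_pinfty_ge; rewrite ger0_real.
by exists (Bop lf cF).
Unshelve. all: by end_near. Qed.

Lemma bop_id_linear H : linear (@idfun H). Proof. by []. Qed.
Lemma bop_id_continuous H : continuous (@idfun H).
Proof. by move=> x; exact: cvg_id. Qed.
Definition bop_id H : bop H H := Bop (@bop_id_linear H) (@bop_id_continuous H).

Section comp.
Variables (H K L : hilbertType R) (A : bop K L) (B : bop H K).
Lemma bop_comp_linear : linear (A \o B).
Proof. by move=> a x y /=; rewrite !linearP. Qed.
Lemma bop_comp_continuous : continuous (A \o B).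
Proof.
by move=> x; apply: continuous_comp; [exact: bop_continuous|exact: bop_continuous].
Qed.
Definition bop_comp : bop H L := Bop bop_comp_linear bop_comp_continuous.
End comp.
End bop_theory.

Section extension.
Variables (R : realType) (X : Type) (E : hilbertType R).
Local Notation C := (Cplx R).
Local Notation S := (seq (C * X)).

Definition lincomb (f : X -> E) (s : S) : E := \sum_(p <- s) p.1 *: f p.2.

Definition span_closure (f : X -> E) (v : E) :=
  forall e : C, 0 < e -> exists s, `|v - lincomb f s| <= e.

(* f spans a dense subspace *)
Definition total (f : X -> E) := forall v, span_closure f v.

Lemma lincomb_cat f s t : lincomb f (s ++ t) = lincomb f s + lincomb f t.
Proof. by rewrite /lincomb big_cat. Qed.
Lemma lincomb_scale f c s : lincomb f (fs_scale c s) = c *: lincomb f s.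
Proof.
by rewrite /lincomb big_map scaler_sumr; apply: eq_bigr => p _; rewrite scalerA.
Qed.
Lemma lincomb1 f x : lincomb f [:: (1, x)] = f x.
Proof. by rewrite /lincomb big_seq1 scale1r. Qed.
Lemma span_closure_gen f x : span_closure f (f x).
Proof. by move=> e e0; exists [:: (1, x)]; rewrite lincomb1 subrr normr0 ltW. Qed.
Lemma span_closure_lin f a v w : span_closure f v -> span_closure f w ->
  span_closure f (a *: v + w).
Proof.
move=> hv hw e e0; have e20 : 0 < e / 2 by rewrite divr_gt0.
have [d d0 de] := small_factor (normr_ge0 a) e20.
have [s hs] := hv _ d0; have [t ht] := hw _ e20.
exists (fs_scale a s ++ t); rewrite lincomb_cat lincomb_scale opprD addrACA.
rewrite -scalerBr [e]splitr; apply: le_trans (ler_normD _ _) _.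
rewrite lerD // normrZ; apply: le_trans (ltW de).
by rewrite ler_wpM2l.
Qed.
Lemma span_closure0 f : span_closure f 0.
Proof.
by move=> e e0; exists [::]; rewrite /lincomb big_nil subrr normr0 ltW.
Qed.
Lemma span_closure_sum f (I : Type) (s : seq I) (c : I -> C) (v : I -> E) :
  (forall i, span_closure f (v i)) ->
  span_closure f (\sum_(i <- s) c i *: v i).
Proof.
move=> h; elim: s => [|i s IH]; first by rewrite big_nil; exact: span_closure0.
by rewrite big_cons; exact: span_closure_lin.
Qed.
Lemma span_closure_closed f v :
  (forall e, 0 < e -> exists2 w, span_closure f w & `|v - w| <= e) ->
  span_closure f v.
Proof.
move=> h e e0; have e20 : 0 < e / 2 by rewrite divr_gt0.
have [w hw vw] := h _ e20; have [s hs] := hw _ e20; exists s.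
rewrite -(subrK w v) -addrA [e]splitr; apply: le_trans (ler_normD _ _) _.
exact: lerD.
Qed.
End extension.

Lemma total_id (R : realType) (E : hilbertType R) : total (@idfun E).
Proof. by move=> v; exact: (span_closure_gen (@idfun E)). Qed.

Lemma bop_total_ext (R : realType) (X : Type) (E E' : hilbertType R)
  (f : X -> E) (A B : bop E E') :
  total f -> (forall x, A (f x) = B (f x)) -> A = B.
Proof.
move=> tf AB; apply: bop_ext => v.
have [M M0 hM] := bop_bounded A; have [N N0 hN] := bop_bounded B.
apply/eqP; rewrite -subr_eq0 -normr_le0.
have P0 : 0 <= M + N by rewrite addr_ge0.
apply: (le_small P0) => e e0; rewrite add0r.
have [s hs] := tf v _ e0.
have E0 : A (lincomb f s) = B (lincomb f s).
  by rewrite /lincomb !linear_sum; apply: eq_bigr => p _; rewrite !linearZ /= AB.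
have -> : A v - B v = A (v - lincomb f s) - B (v - lincomb f s).
  by rewrite (linearB A) (linearB B) /= E0 opprB addrA subrK.
apply: le_trans (ler_normB _ _) _; rewrite mulrDl.
by apply: lerD; [apply: le_trans (hM _) _|apply: le_trans (hN _) _];
  rewrite ler_wpM2l.
Qed.

Section extension_exists.
Variables (R : realType) (X : Type) (E E' : hilbertType R).
Local Notation C := (Cplx R).
Local Notation S := (seq (C * X)).
Variables (f : X -> E) (g : X -> E') (M : C).
Hypothesis M0 : 0 <= M.
Hypothesis tf : total f.
Hypothesis fg : forall s, `|lincomb g s| <= M * `|lincomb f s|.

Definition ext_filter (v : E) : set_system S :=
  filter_from [set e : C | 0 < e] (fun e => [set s | `|v - lincomb f s| <= e]).

Lemma ext_filter_proper v : ProperFilter (ext_filter v).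
Proof.
apply: filter_from_proper; last by move=> e /= /(tf v)[s]; exists s.
apply: filter_from_filter; first by exists 1 => /=; exact: ltr01.
move=> d e /= d0 e0; have [de|ed] := real_leP (gtr0_real d0) (gtr0_real e0).
  by exists d => // s /= hs; split => //; exact: le_trans hs de.
by exists e => // s /= hs; split => //; exact: le_trans hs (ltW ed).
Qed.

Definition ext_fun v : E' := lim (lincomb g s @[s --> ext_filter v]).

Lemma lincombB (F : hilbertType R) (h : X -> F) s t :
  lincomb h s - lincomb h t = lincomb h (s ++ fs_scale (-1) t).
Proof. by rewrite lincomb_cat lincomb_scale scaleN1r. Qed.

Lemma ext_close v s t d e : `|v - lincomb f s| <= d ->
  `|v - lincomb f t| <= e -> `|lincomb g s - lincomb g t| <= M * (d + e).
Proof.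
move=> hs ht; rewrite lincombB; apply: le_trans (fg _) _.
rewrite ler_wpM2l // -lincombB -(subrK v (lincomb f s)) -addrA.
by apply: le_trans (ler_normD _ _) _; rewrite lerD // distrC.
Qed.

Lemma ext_cvg v : lincomb g s @[s --> ext_filter v] --> ext_fun v.
Proof.
have PF := ext_filter_proper v.
suff: cvg (lincomb g s @[s --> ext_filter v]) by [].
apply: cauchy_cvg; apply: cauchy_exP => e e0.
have M20 : 0 <= M *+ 2 by rewrite mulrn_wge0.
have [d d0 Mde] := small_factor M20 e0.
have [t ht] := tf v d0; exists (lincomb g t); exists d => // s /= hs.
rewrite -ball_normE /=; apply: le_lt_trans (ext_close ht hs) _.
by apply: le_lt_trans Mde; rewrite mulrnAl -mulrnAr mulr2n.
Qed.

Lemma ext_approx v s e : 0 <= e -> `|v - lincomb f s| <= e ->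
  `|ext_fun v - lincomb g s| <= M * e.
Proof.
move=> e0 hs; have PF := ext_filter_proper v.
have M1 : 0 <= M + 1 by rewrite addr_ge0.
apply: (le_small M1) => d d0.
have /cvgrPdist_le /(_ d d0) h1 := @ext_cvg v.
have h2 : ext_filter v [set t | `|v - lincomb f t| <= d] by exists d.
have [t [/= ht1 ht2]] := filter_ex (filterI h1 h2).
rewrite -(subrK (lincomb g t) (ext_fun v)) -addrA.
apply: le_trans (ler_normD _ _) _.
have -> : M * e + (M + 1) * d = d + M * (d + e) by ring.
by apply: lerD => //; exact: ext_close ht2 hs.
Qed.

Lemma ext_linear : linear ext_fun.
Proof.
move=> a v w; apply/eqP; rewrite -subr_eq0 -normr_le0.
have P0 : 0 <= M * (`|a| + 1) + `|a| * M + M by rewrite !addr_ge0 ?mulr_ge0 ?addr_ge0.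
apply: (le_small P0) => e e0; rewrite add0r.
have [s hs] := tf v e0; have [t ht] := tf w e0.
have h : `|a *: v + w - lincomb f (fs_scale a s ++ t)| <= (`|a| + 1) * e.
  rewrite lincomb_cat lincomb_scale opprD addrACA -scalerBr mulrDl mul1r.
  apply: le_trans (ler_normD _ _) _; rewrite normrZ lerD //.
  by rewrite ler_wpM2l.
have e1 : 0 <= (`|a| + 1) * e by rewrite mulr_ge0 ?addr_ge0 // ltW.
have h1 := ext_approx e1 h.
have h2 := ext_approx (ltW e0) hs; have h3 := ext_approx (ltW e0) ht.
have -> : ext_fun (a *: v + w) - (a *: ext_fun v + ext_fun w) =
   (ext_fun (a *: v + w) - lincomb g (fs_scale a s ++ t))
   - a *: (ext_fun v - lincomb g s) - (ext_fun w - lincomb g t).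
  rewrite lincomb_cat lincomb_scale scalerBr.
  by rewrite -[RHS]addrA -opprD addrACA -opprD opprB addrA subrK.
have -> : (M * (`|a| + 1) + `|a| * M + M) * e =
    M * ((`|a| + 1) * e) + `|a| * (M * e) + M * e by ring.
apply: le_trans (ler_normB _ _) _; apply: lerD h3.
apply: le_trans (ler_normB _ _) _; apply: lerD h1 _.
by rewrite normrZ ler_wpM2l.
Qed.

Lemma bop_extend : exists A : bop E E', forall x, A (f x) = g x.
Proof.
have bf v : `|ext_fun v| <= M * `|v|.
  have P0 : 0 <= M + M by rewrite addr_ge0.
  apply: (le_small P0) => e e0; have [s hs] := tf v e0.
  rewrite -(subrK (lincomb g s) (ext_fun v)).
  apply: le_trans (ler_normD _ _) _.
  have -> : M * `|v| + (M + M) * e = M * e + M * (`|v| + e) by ring.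
  apply: lerD; first exact: ext_approx (ltW e0) hs.
  apply: le_trans (fg s) _; rewrite ler_wpM2l //.
  rewrite -[lincomb f s](subKr v); apply: le_trans (ler_normB _ _) _.
  exact: lerD.
have [A EA] := bop_of_bounded ext_linear bf M0.
exists A => x; rewrite -EA; apply/eqP; rewrite -subr_eq0 -normr_le0.
have h : `|f x - lincomb f [:: (1, x)]| <= 0 by rewrite lincomb1 subrr normr0.
by have := ext_approx (lexx 0) h; rewrite mulr0 lincomb1.
Qed.
End extension_exists.

Lemma bop_extend_iso (R : realType) (X : Type) (E E' : hilbertType R)
  (f : X -> E) (g : X -> E') :
  total f -> (forall x y, dot (g x) (g y) = dot (f x) (f y)) ->
  exists A : bop E E', forall x, A (f x) = g x.
Proof.
move=> tf fg; apply: (bop_extend (M := 1)) => // s; rewrite mul1r.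
rewrite -(@ler_pXn2r _ 2) ?nnegrE ?normr_ge0 // -!dot_norm.
suff -> : dot (lincomb g s) (lincomb g s) = dot (lincomb f s) (lincomb f s) by [].
rewrite /lincomb !dot_suml; apply: eq_bigr => p _.
rewrite !dot_sumr; apply: eq_bigr => q _.
by rewrite !dotZl !dotZr fg.
Qed.

Section schur.
Variables (R : realType) (V K : hilbertType R) (q : V -> V -> Cplx R).
Local Notation C := (Cplx R).
Hypothesis qDr : forall u v w, q u (v + w) = q u v + q u w.
Hypothesis qZr : forall a u v, q u (a *: v) = a * q u v.
Hypothesis qC : forall u v, (q u v)^* = q v u.
Hypothesis q_ge0 : forall v, 0 <= q v v.

Let qDl u v w : q (u + v) w = q u w + q v w.
Proof. by rewrite -qC qDr rmorphD /= !qC. Qed.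
Let qZl a u v : q (a *: u) v = a^* * q u v.
Proof. by rewrite -qC qZr rmorphM /= qC. Qed.
Let q0r u : q u 0 = 0. Proof. by rewrite -(scale0r 0) qZr mul0r. Qed.
Let q0l u : q 0 u = 0. Proof. by rewrite -qC q0r rmorph0. Qed.
Let q_suml (I : Type) (s : seq I) (f : I -> V) y :
  q (\sum_(i <- s) f i) y = \sum_(i <- s) q (f i) y.
Proof. by elim/big_rec2 : _ => [|i a b _ <-]; [rewrite q0l | rewrite qDl]. Qed.
Let q_sumr (I : Type) (s : seq I) (f : I -> V) y :
  q y (\sum_(i <- s) f i) = \sum_(i <- s) q y (f i).
Proof. by elim/big_rec2 : _ => [|i a b _ <-]; [rewrite q0r | rewrite qDr]. Qed.

Definition schur_form (l : seq (V * K)) : C :=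
  \sum_(p <- l) \sum_(r <- l) q p.1 r.1 * dot p.2 r.2.

Let schur_form0 x l : schur_form ((x, 0) :: l) = schur_form l.
Proof.
rewrite /schur_form big_cons big1 ?add0r => [|p _]; last by rewrite dot0l mulr0.
by apply: eq_bigr => p _; rewrite big_cons /= dot0r mulr0 add0r.
Qed.

(* Schur product theorem, peeling off one direction of K at a time *)
Lemma schur_form_ge0 l : 0 <= schur_form l.
Proof.
move: {2}(size l) (erefl (size l)) => n.
elim: n l => [|n IH] [|[x y] l] //= => [_|[sl]].
  by rewrite /schur_form big_nil.
have [->|y0] := eqVneq y 0; first by rewrite schur_form0 IH.
pose e := `|y|^-1 *: y.
have yn0 : `|y| != 0 by rewrite normr_eq0.
have ee : dot e e = 1.
  rewrite /e dotZl dotZr dot_norm conj_Creal ?rpredV ?normr_real //.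
  by rewrite expr2 mulKf // mulVf.
pose P (v : K) := v - dot e v *: e.
have Py : P y = 0.
  rewrite /P /e dotZl dot_norm conj_Creal ?rpredV ?normr_real // scalerA.
  by rewrite expr2 mulKf // mulfV // scale1r subrr.
clearbody e.
have dP v w : dot v w = (dot e v)^* * dot e w + dot (P v) (P w).
  rewrite /P dotBl !dotBr !dotZl !dotZr ee mulr1 dot_conj.
  by rewrite [dot e w * _]mulrC subrr subr0 addrC subrK.
pose f (p : V * K) := (p.1, P p.2).
have -> : schur_form ((x, y) :: l) =
    q (\sum_(p <- (x, y) :: l) dot e p.2 *: p.1)
      (\sum_(p <- (x, y) :: l) dot e p.2 *: p.1)
    + schur_form (map f ((x, y) :: l)).
  rewrite /schur_form big_map q_suml -big_split; apply: eq_bigr => p _.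
  rewrite big_map q_sumr -big_split; apply: eq_bigr => r _ /=.
  by rewrite qZl qZr [in LHS]dP mulrDr; congr (_ + _); ring.
have fxy : f (x, y) = (x, 0) by rewrite /f /= Py.
rewrite /= fxy schur_form0 addr_ge0 ?q_ge0 // IH //.
by rewrite size_map.
Qed.
End schur.

Section tensor.
Variable R : realType.
Local Notation C := (Cplx R).
Implicit Types H K L : hilbertType R.

Definition tensor_kernel H K (p r : H * K) : C := dot p.1 r.1 * dot p.2 r.2.

Lemma tensor_posdef H K : posdef_kernel (@tensor_kernel H K).
Proof.
split=> [x y|s]; first by rewrite /tensor_kernel rmorphM /= !dot_conj.
have := schur_form_ge0 (@dotDr _ H) (@dotZr _ H) (@dot_conj _ H) (@dot_ge0 _ H)
  [seq (p.1 *: p.2.1, p.2.2) | p <- s].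
rewrite /schur_form /fs_form /fs_eval /fs_fun big_map.
congr (0 <= _); apply: eq_bigr => p _; rewrite big_map mulr_sumr.
apply: eq_bigr => r _ /=; rewrite dotZl dotZr /tensor_kernel; ring.
Qed.

(* Hilbert space tensor product: the completion of the algebraic one, with
   <x ⊗ y, x' ⊗ y'> = <x, x'> <y, y'> *)
Definition htensor H K : hilbertType R := kspace (tensor_posdef H K).
Definition tens H K (x : H) (y : K) : htensor H K := kvec (tensor_posdef H K) (x, y).
End tensor.

Declare Scope hilb_scope.
Delimit Scope hilb_scope with hilb.
Local Open Scope hilb_scope.
Notation "H ⊗ K" := (htensor H K) (at level 40, left associativity) : hilb_scope.
Notation "x ⊗v y" := (tens x y) (at level 40, left associativity) : hilb_scope.
Notation "A ∘ B" := (bop_comp A B) (at level 42, left associativity) : hilb_scope.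

Section tensor_theory.
Variable R : realType.
Local Notation C := (Cplx R).
Implicit Types H K L : hilbertType R.

Lemma dot_tens H K (x x' : H) (y y' : K) :
  dot (x ⊗v y) (x' ⊗v y') = dot x x' * dot y y'.
Proof. exact: dot_kvec. Qed.

Lemma norm_tens H K (x : H) (y : K) : `|x ⊗v y| = `|x| * `|y|.
Proof.
apply/eqP; rewrite -(@eqrXn2 _ 2) ?mulr_ge0 // -dot_norm dot_tens exprMn.
by rewrite !dot_norm.
Qed.

Lemma tens_total H K : total (fun p : H * K => p.1 ⊗v p.2).
Proof.
move=> v e e0; have [s hs] := kvec_total v e0; exists s.
suff -> : lincomb (fun p : H * K => p.1 ⊗v p.2) s =
  \sum_(p <- s) p.1 *: kvec (tensor_posdef H K) p.2 by [].
by apply: eq_bigr => -[a [x y]] _.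
Qed.

Lemma tensP H K (v w : H ⊗ K) :
  (forall x y, dot (x ⊗v y) v = dot (x ⊗v y) w) -> v = w.
Proof.
move=> h; apply: val_inj; apply/funext => -[x y].
by rewrite !kspace_valE'; exact: h.
Qed.

Lemma tens_linl H K (y : K) : linear (fun x : H => x ⊗v y).
Proof.
move=> a x x'; apply: tensP => z t.
by rewrite dotDr dotZr !dot_tens dotDr dotZr mulrDl mulrA.
Qed.
Lemma tens_linr H K (x : H) : linear (fun y : K => x ⊗v y).
Proof.
move=> a y y'; apply: tensP => z t.
by rewrite dotDr dotZr !dot_tens dotDr dotZr mulrDr mulrCA.
Qed.
Lemma tensBl H K (x x' : H) (y : K) : (x - x') ⊗v y = x ⊗v y - x' ⊗v y.
Proof.
apply: tensP => z t; by rewrite dotBr !dot_tens dotBr mulrBl.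
Qed.
Lemma tensBr H K (x : H) (y y' : K) : x ⊗v (y - y') = x ⊗v y - x ⊗v y'.
Proof.
apply: tensP => z t; by rewrite dotBr !dot_tens dotBr mulrBr.
Qed.
Lemma tens_lincombl H K X (f : X -> H) s (y : K) :
  lincomb f s ⊗v y = \sum_(p <- s) p.1 *: (f p.2 ⊗v y).
Proof.
apply: tensP => z t; rewrite dot_tens /lincomb !dot_sumr mulr_suml.
by apply: eq_bigr => p _; rewrite !dotZr dot_tens mulrA.
Qed.
Lemma tens_lincombr H K X (f : X -> K) s (x : H) :
  x ⊗v lincomb f s = \sum_(p <- s) p.1 *: (x ⊗v f p.2).
Proof.
apply: tensP => z t; rewrite dot_tens /lincomb !dot_sumr mulr_sumr.
by apply: eq_bigr => p _; rewrite !dotZr dot_tens mulrCA.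
Qed.

Lemma total_tens H K X Y (f : X -> H) (g : Y -> K) : total f -> total g ->
  total (fun p : X * Y => f p.1 ⊗v g p.2).
Proof.
move=> tf tg; pose h := fun p : X * Y => f p.1 ⊗v g p.2.
have h1 x v : span_closure h (f x ⊗v v).
  apply: span_closure_closed => e e0.
  have [d d0 de] := small_factor (normr_ge0 (f x)) e0.
  have [s hs] := tg v _ d0; exists (f x ⊗v lincomb g s).
    rewrite tens_lincombr; apply: span_closure_sum => p.
    exact: (span_closure_gen h (x, p.2)).
  rewrite -tensBr norm_tens; apply: le_trans (ltW de); exact: ler_wpM2l.
have h2 u v : span_closure h (u ⊗v v).
  apply: span_closure_closed => e e0.
  have [d d0 de] := small_factor (normr_ge0 v) e0.
  have [s hs] := tf u _ d0; exists (lincomb f s ⊗v v).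
    by rewrite tens_lincombl; apply: span_closure_sum => p; exact: h1.
  rewrite -tensBl norm_tens mulrC; apply: le_trans (ltW de); exact: ler_wpM2l.
move=> w; apply: span_closure_closed => e e0.
have [s hs] := tens_total w e0; exists (lincomb (fun p : H * K => p.1 ⊗v p.2) s) => //.
by rewrite /lincomb; apply: span_closure_sum => p; exact: h2.
Qed.

Lemma tens_total3l H K L :
  total (fun p : (H * K) * L => p.1.1 ⊗v p.1.2 ⊗v p.2).
Proof. exact: (total_tens (@tens_total H K) (@total_id _ L)). Qed.
Lemma tens_total3r H K L :
  total (fun p : H * (K * L) => p.1 ⊗v (p.2.1 ⊗v p.2.2)).
Proof. exact: (total_tens (@total_id _ H) (@tens_total K L)). Qed.

Section bound.
Variables (H H' K : hilbertType R) (a : bop H H').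
Local Notation f := (fun p : H * K => p.1 ⊗v p.2).
Local Notation g := (fun p : H * K => a p.1 ⊗v p.2).

Lemma otensl_exists : exists A : bop (H ⊗ K) (H' ⊗ K),
  forall p, A (f p) = g p.
Proof.
have [M M0 hM] := bop_bounded a.
apply: (bop_extend M0 (@tens_total H K)) => s.
rewrite -(@ler_pXn2r _ 2) ?nnegrE ?mulr_ge0 // exprMn -!dot_norm.
pose q (x x' : H) : C := M ^+ 2 * dot x x' - dot (a x) (a x').
have M2 : (M ^+ 2)^* = M ^+ 2 by rewrite conj_Creal // rpredX // ger0_real.
have := @schur_form_ge0 R H K q _ _ _ _ [seq (p.1 *: p.2.1, p.2.2) | p <- s].
have -> : schur_form q [seq (p.1 *: p.2.1, p.2.2) | p <- s] =
    M ^+ 2 * dot (lincomb f s) (lincomb f s)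
    - dot (lincomb g s) (lincomb g s).
  rewrite /schur_form /lincomb big_map !dot_suml mulr_sumr -sumrB.
  apply: eq_bigr => p _; rewrite big_map !dot_sumr mulr_sumr -sumrB.
  apply: eq_bigr => r _ /=; rewrite !dotZl !dotZr !dot_tens /q.
  by rewrite !bopZ !dotZl !dotZr; ring.
rewrite subr_ge0; apply.
- by move=> u v w; rewrite /q bopD !dotDr; ring.
- by move=> c u v; rewrite /q bopZ !dotZr; ring.
- by move=> u v; rewrite /q rmorphB rmorphM /= M2 !dot_conj.
- move=> v; rewrite /q subr_ge0 !dot_norm -exprMn.
  by rewrite ler_pXn2r ?nnegrE ?mulr_ge0.
Qed.
End bound.

Lemma flip_exists H K : exists A : bop (H ⊗ K) (K ⊗ H),
  forall p : H * K, A (p.1 ⊗v p.2) = p.2 ⊗v p.1.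
Proof.
apply: (bop_extend_iso (@tens_total H K) (g := fun p => p.2 ⊗v p.1)) => p r.
by rewrite !dot_tens mulrC.
Qed.
Definition flip H K : bop (H ⊗ K) (K ⊗ H) := projT1 (cid (flip_exists H K)).
Lemma flipE H K (x : H) (y : K) : flip H K (x ⊗v y) = y ⊗v x.
Proof. by rewrite /flip; case: cid => A /= /(_ (x, y)). Qed.

Lemma otens_exists H H' K K' (a : bop H H') (b : bop K K') :
  exists A : bop (H ⊗ K) (H' ⊗ K'),
  forall p, A (p.1 ⊗v p.2) = a p.1 ⊗v b p.2.
Proof.
have [A hA] := otensl_exists K a; have [B hB] := otensl_exists H' b.
exists (flip K' H' ∘ B ∘ flip H' K ∘ A) => p /=.
by rewrite (hA p) flipE (hB (p.2, a p.1)) flipE.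
Qed.
(* the operator a ⊗ b, characterized by otensE *)
Definition otens H H' K K' (a : bop H H') (b : bop K K') :
  bop (H ⊗ K) (H' ⊗ K') := projT1 (cid (otens_exists a b)).
Lemma otensE H H' K K' (a : bop H H') (b : bop K K') x y :
  otens a b (x ⊗v y) = a x ⊗v b y.
Proof. by rewrite /otens; case: cid => A /= /(_ (x, y)). Qed.

Lemma assoc_exists H K L : exists A : bop (H ⊗ K ⊗ L) (H ⊗ (K ⊗ L)),
  forall p : H * K * L, A (p.1.1 ⊗v p.1.2 ⊗v p.2) = p.1.1 ⊗v (p.1.2 ⊗v p.2).
Proof.
apply: (bop_extend_iso (@tens_total3l H K L)
  (g := fun p => p.1.1 ⊗v (p.1.2 ⊗v p.2))) => p r.
by rewrite !dot_tens mulrA.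
Qed.
Definition assoc H K L : bop (H ⊗ K ⊗ L) (H ⊗ (K ⊗ L)) :=
  projT1 (cid (assoc_exists H K L)).
Lemma assocE H K L (x : H) (y : K) (z : L) :
  assoc H K L (x ⊗v y ⊗v z) = x ⊗v (y ⊗v z).
Proof. by rewrite /assoc; case: cid => A /= /(_ ((x, y), z)). Qed.

Lemma assocV_exists H K L : exists A : bop (H ⊗ (K ⊗ L)) (H ⊗ K ⊗ L),
  forall p : H * (K * L), A (p.1 ⊗v (p.2.1 ⊗v p.2.2)) = p.1 ⊗v p.2.1 ⊗v p.2.2.
Proof.
apply: (bop_extend_iso (@tens_total3r H K L)
  (g := fun p => p.1 ⊗v p.2.1 ⊗v p.2.2)) => p r.
by rewrite !dot_tens mulrA.
Qed.
Definition assocV H K L : bop (H ⊗ (K ⊗ L)) (H ⊗ K ⊗ L) :=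
  projT1 (cid (assocV_exists H K L)).
Lemma assocVE H K L (x : H) (y : K) (z : L) :
  assocV H K L (x ⊗v (y ⊗v z)) = x ⊗v y ⊗v z.
Proof. by rewrite /assocV; case: cid => A /= /(_ (x, (y, z))). Qed.

Lemma lunit_exists H : exists A : bop ((CH R : hilbertType R) ⊗ H) H,
  forall p : CH R * H, A (p.1 ⊗v p.2) = (p.1 : C) *: p.2.
Proof.
apply: (bop_extend_iso (@tens_total (CH R) H)
  (g := fun p => (p.1 : C) *: p.2)) => p r.
by rewrite !dot_tens dotZl dotZr mulrA.
Qed.
Definition lunit H : bop ((CH R : hilbertType R) ⊗ H) H :=
  projT1 (cid (lunit_exists H)).
Lemma lunitE H (c : CH R) (x : H) : lunit H (c ⊗v x) = (c : C) *: x.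
Proof. by rewrite /lunit; case: cid => A /= /(_ (c, x)). Qed.

Lemma runit_exists H : exists A : bop (H ⊗ (CH R : hilbertType R)) H,
  forall p : H * CH R, A (p.1 ⊗v p.2) = (p.2 : C) *: p.1.
Proof.
exists (lunit H ∘ flip H _) => p /=; by rewrite flipE lunitE.
Qed.
Definition runit H : bop (H ⊗ (CH R : hilbertType R)) H :=
  projT1 (cid (runit_exists H)).
Lemma runitE H (x : H) (c : CH R) : runit H (x ⊗v c) = (c : C) *: x.
Proof. by rewrite /runit; case: cid => A /= /(_ (x, c)). Qed.
End tensor_theory.

(* The conjugate Hilbert space: same vectors, conjugate scalar action. *)
Definition hconj (R : realType) (H : hilbertType R) : Type := H.

Section conjugate_space.
Variables (R : realType) (H : hilbertType R).
Local Notation C := (Cplx R).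
Local Notation Hb := (hconj H).

HB.instance Definition _ := PseudoMetricNormedZmod.copy Hb H.

Let cscale (a : C) (x : Hb) : Hb := a^* *: (x : H).
Let cscaleA a b x : cscale a (cscale b x) = cscale (a * b) x.
Proof. by rewrite /cscale scalerA rmorphM. Qed.
Let cscale1 : left_id 1 cscale.
Proof. by move=> x; rewrite /cscale rmorph1 scale1r. Qed.
Let cscaleDr : right_distributive cscale +%R.
Proof. by move=> a x y; rewrite /cscale -scalerDr. Qed.
Let cscaleDl x : {morph cscale^~ x : a b / a + b}.
Proof. by move=> a b; rewrite /cscale rmorphD /= scalerDl. Qed.
HB.instance Definition _ :=
  GRing.Zmodule_isLmodule.Build C Hb cscaleA cscale1 cscaleDr cscaleDl.

Let cnormZ (a : C) (x : Hb) : `|a *: x| = `|a| * `|x|.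
Proof. by rewrite [LHS](@normrZ _ H) norm_conjC. Qed.
HB.instance Definition _ :=
  PseudoMetricNormedZmod_Lmodule_isNormedModule.Build C Hb cnormZ.
HB.instance Definition _ := Complete.copy Hb H.

Let cdot (x y : Hb) : C := dot (y : H) (x : H).
Let cdotDr x y z : cdot x (y + z) = cdot x y + cdot x z.
Proof. exact: (@dotDl _ H). Qed.
Let cdotZr a x y : cdot x (a *: y) = a * cdot x y.
Proof. by rewrite /cdot [LHS](@dotZl _ H) conjCK. Qed.
Let cdotC x y : (cdot x y)^* = cdot y x.
Proof. exact: (@dot_conj _ H). Qed.
Let cdotn x : cdot x x = `|x| ^+ 2.
Proof. exact: (@dot_norm _ H). Qed.
HB.instance Definition _ :=
  CompleteNormedModule_isHilbert.Build R Hb cdotDr cdotZr cdotC cdotn.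
End conjugate_space.

Section operators.
Variable R : realType.
Implicit Types H K L : hilbertType R.

Definition nontrivial H : Prop := exists x : H, x != 0.

Definition is_adjoint H K (A : bop H K) (B : bop K H) : Prop :=
  forall x y, dot (B y) x = dot y (A x).

Definition unitary H K (A : bop H K) : Prop :=
  exists B : bop K H,
    [/\ is_adjoint A B, B ∘ A = bop_id H & A ∘ B = bop_id K].

(* closed for the weak operator topology *)
Definition weakly_closed H K (S : set (bop H K)) : Prop :=
  forall A : bop H K,
    (forall (e : Cplx R) (s : seq (K * H)), 0 < e ->
       exists2 B, S B & {in s, forall p, `|dot p.1 (A p.2 - B p.2)| < e}) ->
    S A.

(* Leg numbering on triple products, which are bracketed to the left. *)
Definition leg12 H K L (T : bop (H ⊗ K) (H ⊗ K)) : bop (H ⊗ K ⊗ L) (H ⊗ K ⊗ L) :=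
  otens T (bop_id L).

Definition leg23 H K L (T : bop (K ⊗ L) (K ⊗ L)) : bop (H ⊗ K ⊗ L) (H ⊗ K ⊗ L) :=
  assocV H K L ∘ otens (bop_id H) T ∘ assoc H K L.

Definition flip23 H K L : bop (H ⊗ K ⊗ L) (H ⊗ L ⊗ K) :=
  assocV H L K ∘ otens (bop_id H) (flip K L) ∘ assoc H K L.

Definition leg13 H K L (T : bop (H ⊗ L) (H ⊗ L)) : bop (H ⊗ K ⊗ L) (H ⊗ K ⊗ L) :=
  flip23 H L K ∘ leg12 K T ∘ flip23 H K L.
End operators.

(* A Hilbert space tensor category, displayed over Hilb: the faithful functor
   For is encoded by indexing the objects by their underlying Hilbert space
   (obj H is the class of objects x with For x = H) and by taking the arrows
   x -> y to be the operators coming from the category.  Equalities such as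
   For (x ⊗ y) = For x ⊗ For y then hold by typing. *)
Record hstc (R : realType) := HSTC {
  obj : hilbertType R -> Type;
  hom : forall H K : hilbertType R, obj H -> obj K -> set (bop H K);

  hom_id : forall H (x : obj H), hom x x (bop_id H);
  hom_comp : forall H K L (x : obj H) (y : obj K) (z : obj L)
      (A : bop K L) (B : bop H K),
    hom y z A -> hom x y B -> hom x z (A ∘ B);
  hom_zero : forall H K (x : obj H) (y : obj K) (A : bop H K),
    (forall v, A v = 0) -> hom x y A;
  hom_lin : forall H K (x : obj H) (y : obj K) (c : Cplx R)
      (A B D : bop H K),
    hom x y A -> hom x y B -> (forall v, D v = c *: A v + B v) -> hom x y D;
  hom_adj : forall H K (x : obj H) (y : obj K) (A : bop H K) (B : bop K H),
    is_adjoint A B -> hom x y A -> hom y x B;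
  hom_closed : forall H K (x : obj H) (y : obj K), weakly_closed (hom x y);

  oten : forall H K, obj H -> obj K -> obj (H ⊗ K);
  hom_oten : forall H H' K K' (x : obj H) (x' : obj H') (y : obj K) (y' : obj K')
      (A : bop H H') (B : bop K K'),
    hom x x' A -> hom y y' B -> hom (oten x y) (oten x' y') (otens A B);

  tau : forall H, obj H;
  hom_tau : forall H K (A : bop H K), hom (tau H) (tau K) A;
  tau_oten : forall H K, tau (H ⊗ K) = oten (tau H) (tau K);

  hom_assoc : forall H K L (x : obj H) (y : obj K) (z : obj L),
    hom (oten (oten x y) z) (oten x (oten y z)) (assoc H K L);
  hom_lunit : forall H (x : obj H), hom (oten (tau (CH R)) x) x (lunit H);
  hom_runit : forall H (x : obj H), hom (oten x (tau (CH R))) x (runit H);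

  hom_id_eq : forall H (x x' : obj H), hom x x' (bop_id H) -> x = x';
  (* For L = 0 these two conditions would force hom x y to contain every
     operator, since then otens A (bop_id L) = 0. *)
  hom_cancelr : forall H K L (x : obj H) (x' : obj K) (y : obj L) (A : bop H K),
    nontrivial L -> hom (oten x y) (oten x' y) (otens A (bop_id L)) -> hom x x' A;
  hom_cancell : forall H K L (x : obj H) (x' : obj K) (y : obj L) (A : bop H K),
    nontrivial L -> hom (oten y x) (oten y x') (otens (bop_id L) A) -> hom x x' A }.

Record right_absorber (R : realType) (C : hstc R) (H : hilbertType R) :=
  RightAbsorber {
  ra_obj :> obj C H;
  ra_U : forall K, obj C K -> bop (K ⊗ H) (K ⊗ H);
  ra_unitary : forall K (x : obj C K), unitary (ra_U x);
  ra_hom : forall K (x : obj C K),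
    hom (oten x ra_obj) (oten (tau C K) ra_obj) (ra_U x);
  ra_natural : forall K L (x : obj C K) (y : obj C L) (A : bop K L), hom x y A ->
    ra_U y ∘ otens A (bop_id H) = otens A (bop_id H) ∘ ra_U x;
  ra_oten : forall K L (x : obj C K) (y : obj C L),
    ra_U (oten x y) = leg13 L (ra_U x) ∘ leg23 K (ra_U y) }.

Section quantum_groups.
Variable R : realType.
Implicit Types H K : hilbertType R.

(* Unbounded operators are represented by their graphs. *)
Definition graph_adjoint H (Q : set (H * H)) : set (H * H) :=
  [set p | forall r, Q r -> dot p.1 r.2 = dot p.2 r.1].

Record strictly_positive H (Q : set (H * H)) : Prop := StrictlyPositive {
  sp_zero : Q (0, 0);
  sp_lin : forall (c : Cplx R) p r, Q p -> Q r ->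
    Q (c *: p.1 + r.1, c *: p.2 + r.2);
  sp_fun : forall x y y', Q (x, y) -> Q (x, y') -> y = y';
  sp_dense : dense [set p.1 | p in Q];
  sp_selfadjoint : graph_adjoint Q = Q;
  sp_pos : forall x y, Q (x, y) -> 0 <= dot x y;
  sp_ker : forall x, Q (x, 0) -> x = 0 }.

(* closure of the algebraic tensor product of two graphs; scalars are absorbed
   into the first legs *)
Definition graph_tens H K (P : set (H * H)) (Q : set (K * K)) :
    set ((H ⊗ K) * (H ⊗ K)) :=
  closure [set p | exists2 s : seq ((H * H) * (K * K)),
    (forall i, i \in s -> P i.1 /\ Q i.2) &
    p = (\sum_(i <- s) (i.1.1 ⊗v i.2.1), \sum_(i <- s) (i.1.2 ⊗v i.2.2))].

Definition graph_conj H (A B : bop H H) (Q : set (H * H)) : set (H * H) :=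
  [set p | exists2 v, Q (B p.1, v) & p.2 = A v].

Definition manageable H (W : bop (H ⊗ H) (H ⊗ H)) : Prop :=
  exists (Q : set (H * H)) (Wt : bop ((hconj H : hilbertType R) ⊗ H)
                                     ((hconj H : hilbertType R) ⊗ H)),
  [/\ strictly_positive Q, unitary Wt,
      forall Wadj, is_adjoint W Wadj ->
        graph_conj Wadj W (graph_tens Q Q) = graph_tens Q Q
    & forall (x z u Qu y Qiy : H), Q (u, Qu) -> Q (Qiy, y) ->
        dot (x ⊗v u) (W (z ⊗v y)) =
        dot ((z : hconj H) ⊗v Qu) (Wt ((x : hconj H) ⊗v Qiy))].

Definition multiplicative_unitary H (W : bop (H ⊗ H) (H ⊗ H)) : Prop :=
  unitary W /\ leg23 H W ∘ leg12 H W = leg12 H W ∘ leg13 H W ∘ leg23 H W.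

(* norm closure of the linear span of the slices (ω ⊗ id) W, for the vector
   functionals ω T = <x, T y>; the operator norm is computed on matrix
   coefficients, and scalars are absorbed into y *)
Definition slice_algebra H (W : bop (H ⊗ H) (H ⊗ H)) : set (bop H H) :=
  [set A | forall e : Cplx R, 0 < e -> exists s : seq (H * H), forall u v : H,
    `|dot u (A v) - \sum_(p <- s) dot (p.1 ⊗v u) (W (p.2 ⊗v v))|
       <= e * `|u| * `|v|].

(* The C*-bialgebra on H generated by a manageable multiplicative unitary W:
   the comultiplication is c |-> W (c ⊗ 1) W^* on cqg_alg (and unspecified
   elsewhere). *)
Record cqgroup H := CQGroup {
  cqg_alg : set (bop H H);
  cqg_comul : bop H H -> bop (H ⊗ H) (H ⊗ H);
  cqg_mu : bop (H ⊗ H) (H ⊗ H);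
  cqg_multiplicative : multiplicative_unitary cqg_mu;
  cqg_manageable : manageable cqg_mu;
  cqg_algE : cqg_alg = slice_algebra cqg_mu;
  cqg_comulE : forall c, cqg_alg c ->
    cqg_comul c ∘ cqg_mu = cqg_mu ∘ otens c (bop_id H) }.

Definition qmorphism H1 H2 (G1 : cqgroup H1) (G2 : cqgroup H2)
    (X : bop (H1 ⊗ H2) (H1 ⊗ H2)) : Prop :=
  [/\ unitary X,
      leg23 H1 X ∘ leg12 H2 (cqg_mu G1)
        = leg12 H2 (cqg_mu G1) ∘ leg13 H1 X ∘ leg23 H1 X
    & leg23 H1 (cqg_mu G2) ∘ leg12 H2 X
        = leg12 H2 X ∘ leg13 H2 X ∘ leg23 H1 (cqg_mu G2)].

(* Z is the composite Y * X; it can only be unique when H2 is nontrivial,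
   every operator on H1 ⊗ 0 ⊗ H3 being 0 *)
Definition qcomposite H1 H2 H3 (X : bop (H1 ⊗ H2) (H1 ⊗ H2))
    (Y : bop (H2 ⊗ H3) (H2 ⊗ H3)) (Z : bop (H1 ⊗ H3) (H1 ⊗ H3)) : Prop :=
  unique (fun Z' => unitary Z' /\
    leg23 H1 Y ∘ leg12 H3 X = leg12 H3 X ∘ leg13 H2 Z' ∘ leg23 H1 Y) Z.

Definition qinverse H1 H2 (G1 : cqgroup H1) (G2 : cqgroup H2)
    (X : bop (H1 ⊗ H2) (H1 ⊗ H2)) (Y : bop (H2 ⊗ H1) (H2 ⊗ H1)) : Prop :=
  [/\ qmorphism G1 G2 X, qmorphism G2 G1 Y,
      qcomposite X Y (cqg_mu G1) & qcomposite Y X (cqg_mu G2)].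
End quantum_groups.

(* Main.v *)
Require Import Defs.
From mathcomp Require Import all_boot all_order all_algebra.
From mathcomp Require Import all_classical all_reals topology normedtype.

Set Implicit Arguments.
Unset Strict Implicit.
Unset Printing Implicit Defensive.

Import Order.TTheory GRing.Theory Num.Theory.

Local Open Scope ring_scope.
Local Open Scope hilb_scope.

(** All six equations are instances of one: if [U], [U'] are natural right
    absorbers and [x] is an object, then [U'^x] is an arrow from [x ⊗ ρ'] to
    [τ(x) ⊗ ρ'], so naturality of [U] and its multiplicativity (ii) give
    [U^{ρ'}_23 U'^x_12 = U'^x_12 U^x_13 U^{ρ'}_23], because [U^{τ(x)} = 1].
    The last fact follows by naturality from the case [x = ℂ], where (ii) shows
    that the unitary [U^{τ(ℂ)}] is idempotent. The pentagon equation and the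
    equations for bicharacters and composites are these six equations. *)

Section tensor_lemmas.
Variable R : realType.
Implicit Types H K L M : hilbertType R.

Lemma bop_compA H K L M (A : bop L M) (B : bop K L) (D : bop H K) :
  A ∘ (B ∘ D) = A ∘ B ∘ D.
Proof. exact: bop_ext. Qed.

Lemma bop_comp1l H K (A : bop H K) : bop_id K ∘ A = A.
Proof. exact: bop_ext. Qed.

Lemma bop_comp1r H K (A : bop H K) : A ∘ bop_id H = A.
Proof. exact: bop_ext. Qed.

(** Composition of functions is associative by computation, so evaluating at a vector avoids all
    rebracketing; one-sided inverses suffice. *)
Lemma bop_comp_cancel H H' K K' (A' : bop K' K) (A : bop K K') (B : bop H' H)
    (B' : bop H H') (T : bop H K) :
  A' ∘ A = bop_id K -> B ∘ B' = bop_id H -> A' ∘ (A ∘ T ∘ B) ∘ B' = T.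
Proof.
move=> AA BB; apply: bop_ext => v.
by rewrite -[LHS]/((A' ∘ A) (T ((B ∘ B') v))) AA BB.
Qed.

Lemma tens_ext H K L (A B : bop (H ⊗ K) L) :
  (forall x y, A (x ⊗v y) = B (x ⊗v y)) -> A = B.
Proof. by move=> AB; apply: (bop_total_ext (@tens_total R H K)) => -[]. Qed.

Lemma tens_ext3l H K L M (A B : bop (H ⊗ K ⊗ L) M) :
  (forall x y z, A (x ⊗v y ⊗v z) = B (x ⊗v y ⊗v z)) -> A = B.
Proof. by move=> AB; apply: (bop_total_ext (@tens_total3l R H K L)) => -[[]]. Qed.

Lemma tens_ext3r H K L M (A B : bop (H ⊗ (K ⊗ L)) M) :
  (forall x y z, A (x ⊗v (y ⊗v z)) = B (x ⊗v (y ⊗v z))) -> A = B.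
Proof. by move=> AB; apply: (bop_total_ext (@tens_total3r R H K L)) => -[? []]. Qed.

(** The norm is multiplicative on elementary tensors, so $(x-x')\otimes y=0$ forces $x=x'$. *)
Lemma tens_injl H K (y : K) : y != 0 -> injective (fun x : H => x ⊗v y).
Proof.
move=> y0 x x' /eqP; rewrite -subr_eq0 -tensBl -normr_eq0 norm_tens.
by rewrite mulf_eq0 !normr_eq0 (negbTE y0) orbF subr_eq0 => /eqP.
Qed.

Lemma tens_injr H K (x : H) : x != 0 -> injective (fun y : K => x ⊗v y).
Proof.
move=> x0 y y' /eqP; rewrite -subr_eq0 -tensBr -normr_eq0 norm_tens.
by rewrite mulf_eq0 !normr_eq0 (negbTE x0) /= subr_eq0 => /eqP.
Qed.

Lemma assocK H K L : assocV H K L ∘ assoc H K L = bop_id _.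
Proof. by apply: tens_ext3l => x y z; rewrite /= assocE assocVE. Qed.

Lemma assocVK H K L : assoc H K L ∘ assocV H K L = bop_id _.
Proof. by apply: tens_ext3r => x y z; rewrite /= assocVE assocE. Qed.

Lemma otens_comp H H' H'' K K' K'' (A : bop H' H'') (B : bop H H')
    (A' : bop K' K'') (B' : bop K K') :
  otens (A ∘ B) (A' ∘ B') = otens A A' ∘ otens B B'.
Proof. by apply: tens_ext => x y; rewrite /= !otensE. Qed.

Lemma otens_id H K : otens (bop_id H) (bop_id K) = bop_id (H ⊗ K).
Proof. by apply: tens_ext => x y; rewrite /= otensE. Qed.

Lemma leg12_id H K L : leg12 L (bop_id (H ⊗ K)) = bop_id (H ⊗ K ⊗ L).
Proof. exact: otens_id. Qed.

Lemma leg12_comp H K L (A B : bop (H ⊗ K) (H ⊗ K)) :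
  leg12 L (A ∘ B) = leg12 L A ∘ leg12 L B.
Proof. by rewrite /leg12 -otens_comp bop_comp1l. Qed.

Lemma leg23_id H K L : leg23 H (bop_id (K ⊗ L)) = bop_id (H ⊗ K ⊗ L).
Proof. by rewrite /leg23 otens_id bop_comp1r assocK. Qed.

Lemma leg23_comp H K L (A B : bop (K ⊗ L) (K ⊗ L)) :
  leg23 H (A ∘ B) = leg23 H A ∘ leg23 H B.
Proof.
rewrite /leg23 !bop_compA -(bop_compA _ (assoc H K L)) assocVK bop_comp1r.
by rewrite -(bop_compA _ _ (otens _ B)) -otens_comp bop_comp1l.
Qed.

Lemma leg23E H K L (T : bop (K ⊗ L) (K ⊗ L)) (x : H) y z :
  leg23 H T (x ⊗v y ⊗v z) = assocV H K L (x ⊗v T (y ⊗v z)).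
Proof. by rewrite /= assocE otensE. Qed.

Lemma flip23E H K L (x : H) (y : K) (z : L) :
  flip23 H K L (x ⊗v y ⊗v z) = x ⊗v z ⊗v y.
Proof. by rewrite /= assocE otensE flipE assocVE. Qed.

Lemma flip23K H K L : flip23 H L K ∘ flip23 H K L = bop_id _.
Proof.
apply: tens_ext3l => x y z.
by rewrite -[LHS]/(flip23 H L K (flip23 H K L _)) !flip23E.
Qed.

Lemma leg13E H K L (T : bop (H ⊗ L) (H ⊗ L)) x (y : K) z :
  leg13 K T (x ⊗v y ⊗v z) = flip23 H L K (T (x ⊗v z) ⊗v y).
Proof.
by rewrite -[LHS]/(flip23 H L K (leg12 K T (flip23 H K L _))) flip23E otensE.
Qed.

Lemma leg13_id H K L : leg13 K (bop_id (H ⊗ L)) = bop_id (H ⊗ K ⊗ L).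
Proof. by rewrite /leg13 leg12_id bop_comp1r flip23K. Qed.

(** Put a nonzero vector $k$ in the middle leg: undoing the flip in [leg13E] leaves $T(x\otimes
    z)\otimes k$, from which $k$ can be cancelled. *)
Lemma leg13_inj H K L : nontrivial K ->
  injective (@leg13 R H K L).
Proof.
move=> [k k0] A B AB; apply: tens_ext => x z.
apply: (tens_injl k0); have := congr1 (fun T : bop _ _ => T (x ⊗v k ⊗v z)) AB.
rewrite !leg13E => /(congr1 (flip23 H K L)).
have flK v : flip23 H K L (flip23 H L K v) = v.
  by rewrite -[LHS]/((flip23 H K L ∘ flip23 H L K) v) flip23K.
by rewrite !flK.
Qed.

Lemma unitary_inj H K (A : bop H K) : unitary A -> injective A.
Proof.
case=> B [_ BA _] x y /(congr1 B).
by rewrite -![B (A _)]/((B ∘ A) _) BA.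
Qed.

(** This yields the uniqueness of composites of bicharacters. *)
Lemma leg13_cancel H K L (X : bop (H ⊗ K) (H ⊗ K)) (Y : bop (K ⊗ L) (K ⊗ L))
    (Z Z' : bop (H ⊗ L) (H ⊗ L)) :
  unitary X -> unitary Y -> nontrivial K ->
  leg12 L X ∘ leg13 K Z ∘ leg23 H Y = leg12 L X ∘ leg13 K Z' ∘ leg23 H Y ->
  Z = Z'.
Proof.
move=> [X' [_ X'X _]] [Y' [_ _ YY']] K0 E; apply: (leg13_inj K0).
have XX : leg12 L X' ∘ leg12 L X = bop_id _ by rewrite -leg12_comp X'X leg12_id.
have YY : leg23 H Y ∘ leg23 H Y' = bop_id _ by rewrite -leg23_comp YY' leg23_id.
by rewrite -[LHS](bop_comp_cancel _ XX YY) E bop_comp_cancel.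
Qed.

(** Since $\tau$ is defined on all bounded operators, this makes each vector an arrow out of
    $\tau(\mathbb C)$, to which naturality applies. *)
Lemma vector_bop_exists K (v : K) :
  exists A : bop (CH R) K, forall c : CH R, A c = (c : Cplx R) *: v.
Proof.
have lin : linear (fun c : CH R => (c : Cplx R) *: v).
  by move=> a c d; rewrite scalerDl scalerA.
have [A EA] := @bop_of_bounded R (CH R) K _ `|v| lin
  (fun c => ltac:(by rewrite normrZ mulrC)) (normr_ge0 v).
by exists A => c; rewrite -EA.
Qed.

(** The map $x\mapsto 1\otimes x$ inverts [lunit], so every vector of $\mathbb C\otimes H$ is an
    elementary tensor with first factor 1. *)
Lemma tens1_lunit H (w : (CH R : hilbertType R) ⊗ H) :
  ((1 : Cplx R) : CH R) ⊗v lunit H w = w.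
Proof.
have [A EA] := @bop_of_bounded R H ((CH R : hilbertType R) ⊗ H) _ 1
  (@tens_linr R (CH R) H ((1 : Cplx R) : CH R))
  (fun x => ltac:(by rewrite norm_tens normr1)) ler01.
suff E : A ∘ lunit H = bop_id _.
  by rewrite -[RHS]/(bop_id _ w) -E /= -EA.
apply: tens_ext => c x; rewrite /= lunitE bopZ -EA.
apply: tensP => d y; rewrite dotZr !dot_tens mulrA; congr (_ * _).
by rewrite -dotZr; congr (dot _ _); exact: mulr1.
Qed.

End tensor_lemmas.

Section absorbers.
Variables (R : realType) (C : hstc R).

Lemma ra_U_unit H (rho : right_absorber C H) :
  ra_U rho (tau C (CH R)) = bop_id ((CH R : hilbertType R) ⊗ H).
Proof.
set u := ra_U rho _; pose e : CH R := (1 : Cplx R).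
have e0 : e != 0 by exact: oner_neq0.
pose s h := lunit H (u (e ⊗v h)).
(* Thus $u$ is encoded by a map $s$ on $H$, and idempotency of $u$ becomes $s\circ s=s$. *)
have us h : u (e ⊗v h) = e ⊗v s h by rewrite /s tens1_lunit.
(* The arrow $1\mapsto e\otimes e$ goes from $\tau(\mathbb C)$ to $\tau(\mathbb
   C)\otimes\tau(\mathbb C)$. At $e\otimes h$, naturality compares $e\otimes e\otimes s(h)$ with
   $u_{13}u_{23}(e\otimes e\otimes h)=e\otimes e\otimes s(s(h))$. *)
have [A EA] := vector_bop_exists (e ⊗v e).
have ss h : s (s h) = s h.
  have := ra_natural rho (hom_tau C A).
  rewrite tau_oten ra_oten -/u => /(congr1 (fun T : bop _ _ => T (e ⊗v h))).
  rewrite -[LHS]/(leg13 _ u (leg23 _ u (otens _ _ _))) -[RHS]/(otens _ _ (u _)).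
  rewrite us !otensE EA scale1r.
  rewrite leg23E us assocVE leg13E us flip23E.
  by apply: tens_injr; rewrite -normr_eq0 norm_tens mulf_neq0 ?normr_eq0.
apply: tens_ext => c h.
have -> : c ⊗v h = (c : Cplx R) *: (e ⊗v h).
  apply: tensP => d y; rewrite dotZr !dot_tens mulrA; congr (_ * _).
  by rewrite -dotZr; congr (dot _ _); rewrite [RHS]mulr1.
rewrite !bopZ; congr (_ *: _) => /=.
by apply: (unitary_inj (ra_unitary rho (tau C (CH R)))); rewrite -/u !us ss.
Qed.

Lemma ra_U_tau H K (rho : right_absorber C H) :
  ra_U rho (tau C K) = bop_id (K ⊗ H).
Proof.
apply: tens_ext => v h; have [A EA] := vector_bop_exists v.
have := ra_natural rho (hom_tau C A); rewrite ra_U_unit bop_comp1r.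
move=> /(congr1 (fun T : bop _ _ => T (((1 : Cplx R) : CH R) ⊗v h))).
by rewrite /= otensE EA scale1r.
Qed.

(** Letting [rho], [rho'] and [x] each range over two given absorbers yields eight equations: the
    six claimed and the two pentagons. *)
Lemma ra_U_leg H H' K (rho : right_absorber C H) (rho' : right_absorber C H')
    (x : obj C K) :
  leg23 K (ra_U rho rho') ∘ leg12 H (ra_U rho' x) =
  leg12 H (ra_U rho' x) ∘ leg13 H' (ra_U rho x) ∘ leg23 K (ra_U rho rho').
Proof.
have := ra_natural rho (ra_hom rho' x).
by rewrite !ra_oten ra_U_tau leg13_id bop_comp1l bop_compA.
Qed.

End absorbers.

Lemma cqgroup_of_manageable (R : realType) (H : hilbertType R)
    (W : bop (H ⊗ H) (H ⊗ H)) :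
  multiplicative_unitary W -> manageable W ->
  exists G : cqgroup H, cqg_mu G = W.
Proof.
move=> muW mW; have [[B [_ BW _]] _] := muW.
(* [B] is $W^*$; the comultiplication $c\mapsto W(c\otimes 1)W^*$ is taken on all operators. *)
have comulE (c : bop H H) : slice_algebra W c ->
    (W ∘ otens c (bop_id H) ∘ B) ∘ W = W ∘ otens c (bop_id H).
  by rewrite -bop_compA BW bop_comp1r.
by exists (CQGroup muW mW erefl comulE).
Qed.

Theorem proposition2p13 (R : realType) (C : hstc R) (H H' : hilbertType R)
    (rho : right_absorber C H) (rho' : right_absorber C H') :
  let U : bop (H ⊗ H) (H ⊗ H) := ra_U rho (ra_obj rho) in
  let U' : bop (H' ⊗ H') (H' ⊗ H') := ra_U rho' (ra_obj rho') in
  let V : bop (H' ⊗ H) (H' ⊗ H) := ra_U rho (ra_obj rho') in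
  let W : bop (H ⊗ H') (H ⊗ H') := ra_U rho' (ra_obj rho) in
  [/\ leg23 H' U ∘ leg12 H V = leg12 H V ∘ leg13 H V ∘ leg23 H' U
    /\ leg23 H U' ∘ leg12 H' W = leg12 H' W ∘ leg13 H' W ∘ leg23 H U',
      leg23 H' V ∘ leg12 H U' = leg12 H U' ∘ leg13 H' V ∘ leg23 H' V
    /\ leg23 H W ∘ leg12 H' U = leg12 H' U ∘ leg13 H W ∘ leg23 H W,
      leg23 H V ∘ leg12 H W = leg12 H W ∘ leg13 H' U ∘ leg23 H V
    /\ leg23 H' W ∘ leg12 H' V = leg12 H' V ∘ leg13 H U' ∘ leg23 H' W
    & nontrivial H -> nontrivial H' -> manageable U -> manageable U' ->
      exists (G : cqgroup H) (G' : cqgroup H'),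
        [/\ cqg_mu G = U, cqg_mu G' = U' & qinverse G' G V W]].
Proof.
move=> U U' V W; do !split; try exact: ra_U_leg.
move=> H0 H'0 mU mU'.
have [G EG] : exists G : cqgroup H, cqg_mu G = U.
  by apply: cqgroup_of_manageable mU; split; [exact: ra_unitary|exact: ra_U_leg].
have [G' EG'] : exists G : cqgroup H', cqg_mu G = U'.
  by apply: cqgroup_of_manageable mU'; split; [exact: ra_unitary|exact: ra_U_leg].
exists G, G'; split => //; split; rewrite ?EG ?EG'.
- by split; rewrite ?EG ?EG'; [exact: ra_unitary|exact: ra_U_leg..].
- by split; rewrite ?EG ?EG'; [exact: ra_unitary|exact: ra_U_leg..].
- split; first by split; [exact: ra_unitary|exact: ra_U_leg].
  (* A competitor $Z$ satisfies $V_{12}Z_{13}W_{23}=W_{23}V_{12}=V_{12}\check U_{13}W_{23}$, and the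
     middle leg $H$ is nonzero. *)
  move=> Z [_ EZ]; apply: (leg13_cancel (ra_unitary rho rho')
    (ra_unitary rho' rho) H0).
  by rewrite -EZ ra_U_leg.
- split; first by split; [exact: ra_unitary|exact: ra_U_leg].
  move=> Z [_ EZ]; apply: (leg13_cancel (ra_unitary rho' rho)
    (ra_unitary rho rho') H'0).
  by rewrite -EZ ra_U_leg.
Qed.
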